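(* Every subcubic planar graph with girth at least $12$ has a $(1,2^5)$-packing edge-coloring.
   Context: Graphs are finite and simple. A graph is subcubic if its maximum degree is at most $3$. The girth of a graph is the length of a shortest cycle, with the girth of a forest taken to be infinite. For distinct edges $e,f$ of $G$, the distance between $e$ and $f$ is the distance between the corresponding vertices of the line graph $L(G)$ (so edges sharing an endpoint are at distance $1$). A $(1^j,2^k)$-packing edge-coloring of $G$ is a partition of $E(G)$ into $j+k$ classes (possibly empty) such that in each of the first $j$ classes any two distinct edges are at distance at least $2$ (the class is a matching), and in each of the remaining $k$ classes any two distinct edges are at distance at least $3$ (the class is an induced matching). Thus a $(1,2^5)$-packing edge-coloring is a partition of $E(G)$ into one matching and five induced matchings. *)

(* Defs.v *)
From mathcomp Require Import all_boot all_order all_algebra.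
From mathcomp Require Import all_classical all_reals all_analysis.

Set Implicit Arguments.
Unset Strict Implicit.
Unset Printing Implicit Defensive.

Import Order.TTheory GRing.Theory Num.Theory.
Import numFieldNormedType.Exports.

Record sgraph := SGraph {
  vertex :> finType;
  adj : rel vertex;
  adj_sym : symmetric adj;
  adj_irrefl : irreflexive adj }.

Definition edge_set (G : sgraph) : {set {set G}} :=
  [set [set u; v] | u in G, v in G & adj u v].

Definition edge (G : sgraph) : finType := {E : {set G} | E \in edge_set G}.

Definition degree (G : sgraph) (v : G) : nat := #|[set w | adj v w]|.

Definition subcubic (G : sgraph) : Prop := forall v : G, degree v <= 3.

(* [ucycle] also accepts the sequences [:: u; v] with u adjacent to v, whence
   the bound on the size. *)
Definition is_cycle (G : sgraph) (c : seq G) : Prop :=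
  ucycle (@adj G) c /\ 2 < size c.

(* A forest has infinite girth, so it satisfies this for every g. *)
Definition girth_geq (G : sgraph) (g : nat) : Prop :=
  forall c : seq G, is_cycle c -> g <= size c.

Definition line_adj (G : sgraph) : rel (edge G) :=
  fun E F => (E != F) && (val E :&: val F != finset.set0)%SET.

Lemma line_adj_sym (G : sgraph) : symmetric (@line_adj G).
Proof. by move=> E F; rewrite /line_adj eq_sym finset.setIC. Qed.

Lemma line_adj_irrefl (G : sgraph) : irreflexive (@line_adj G).
Proof. by move=> E; rewrite /line_adj eqxx. Qed.

Definition line_graph (G : sgraph) : sgraph :=
  SGraph (@line_adj_sym G) (@line_adj_irrefl G).

(* The length of a shortest walk from x to y is at least d; the distance between
   vertices of different components is infinite. *)
Definition dist_geq (G : sgraph) (d : nat) (x y : G) : Prop :=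
  forall p : seq G, path (@adj G) x p -> last x p = y -> d <= size p.

(* The classes are the fibres of c: the j fibres over the left summand are
   matchings and the k fibres over the right summand are induced matchings. *)
Definition is_packing_coloring (G : sgraph) (j k : nat)
    (c : edge G -> 'I_j + 'I_k) : Prop :=
  forall E F : edge G, E != F -> c E = c F ->
    @dist_geq (line_graph G) (if c E is inl _ then 2 else 3) E F.

Definition packing_edge_colorable (G : sgraph) (j k : nat) : Prop :=
  exists c : edge G -> 'I_j + 'I_k, is_packing_coloring c.

Local Open Scope classical_set_scope.
Local Open Scope ring_scope.

Record is_plane_drawing (R : realType) (G : sgraph)
    (pos : G -> R * R) (arc : edge G -> R -> R * R) : Prop := {
  pos_inj : injective pos;
  arc_cont : forall E : edge G, {within `[0, 1], continuous (arc E)};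
  arc_inj : forall E : edge G, {in `[0, 1] &, injective (arc E)};
  arc_ends : forall E : edge G, exists u v : G,
    [/\ val E = [set u; v]%SET, arc E 0 = pos u & arc E 1 = pos v];
  arc_vertex : forall (E : edge G) (t : R) (v : G),
    t \in `]0, 1[ -> arc E t <> pos v;
  arc_disj : forall (E F : edge G) (s t : R), E != F ->
    s \in `]0, 1[ -> t \in `]0, 1[ -> arc E s <> arc F t }.

Definition planar (R : realType) (G : sgraph) : Prop :=
  exists (pos : G -> R * R) (arc : edge G -> R -> R * R),
    is_plane_drawing pos arc.

(* Main.v *)
Require Import Defs.
From HB Require Import structures.
From mathcomp Require boolp.
From mathcomp Require Import all_boot all_order all_algebra.
From mathcomp Require Import zify ring lra.

(* A coloring is recorded by a set [S v] of three colors at every vertex [v],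
   containing the colors of the edges at [v], such that [S u] and [S v] share at
   most the color of [uv] and the matching color 0. The colors of [S v] that no
   edge at [v] uses are free, and one of them may be traded for 0; so an
   uncolored part may be colored as if every vertex on its boundary had 0 in its
   set. Hence, in a minimal uncolorable vertex set [A] without short cycles, all
   degrees are 2 or 3, no three vertices of degree 2 are consecutive, and at most
   three vertices of degree 2, counted along the threads, surround a vertex of
   degree 3. Discharging gives [12 |A| <= 5 (sum of the degrees in A)].

   On the other hand, covering a plane drawing of [G] by a fine square grid shows
   that [G] is a minor of a grid. The cycle space modulo 2 of a grid is spanned
   by its unit squares, so that of the graph on [A] is spanned by the boundaries
   of its faces, the classes of squares connected across grid edges not used by
   the minor. Every edge is on at most two of them, and a nonzero boundary has at
   least 12 edges, so [12 (m - |A| + 1) <= 2 m] for the number [m] of edges; this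
   contradicts the bound above. *)

Set Implicit Arguments.
Unset Strict Implicit.
Unset Printing Implicit Defensive.

(** * Colorings of vertex subsets *)

(** The constraint at distance 2 involves all edges around an edge [uv]. Recording the palettes [S]
    makes it a condition between neighbors, so a coloring can be extended vertex by vertex without
    revising earlier palettes; the price is that a new edge at [u] must take one of the colors that
    [S u] still holds in reserve. Small configurations can nevertheless be filled, because two
    boundary palettes that both contain 0 miss at least one of the six colors. The constants are
    those of planar graphs of girth 12: their average degree is below 2 * 12 / (12 - 2) = 12/5,
    while discharging shows that a minimal uncolorable set has average degree at least 12/5. The
    bounds meet exactly, and the strictness comes from the +1 in the dimension of the cycle space.
    Euler's formula enters as a single inequality, dimension of the cycle space against size of a
    spanning set of face boundaries. The arcs of a drawing may be arbitrarily wild; all that is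
    extracted from them is connectedness and positive distances between disjoint compact sets, which
    a fine enough grid preserves. *)

Lemma color_avoiding (D : {set 'I_6}) : #|D| <= 5 -> exists a, a \notin D.
Proof.
move=> D5; have /card_gt0P[a] : 0 < #|~: D| by rewrite cardsCs setCK card_ord; lia.
by rewrite inE; exists a.
Qed.

Lemma color_avoiding_cons (D : {set 'I_6}) (s : seq 'I_6) :
  #|D| + size s <= 5 -> exists2 a, a \notin D & a \notin s.
Proof.
move=> D5; have [|a] := @color_avoiding (D :|: [set x in s]).
  rewrite (leq_trans (leq_card_setU _ _)) // (leq_trans _ D5) // leq_add2l.
  by rewrite cardsE card_size.
by rewrite !inE negb_or => /andP[]; exists a.
Qed.

(** The two sets overlap in 0, so together they have at most five of the six colors. *)
Lemma color_avoiding_two (D E : {set 'I_6}) :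
    #|D| = 3 -> #|E| = 3 -> ord0 \in D -> ord0 \in E ->
  exists2 a, a \notin D & a \notin E.
Proof.
move=> D3 E3 D0 E0; have [|a] := @color_avoiding (D :|: E).
  have : 0 < #|D :&: E| by apply/card_gt0P; exists ord0; rewrite inE D0.
  by have := cardsU D E; rewrite D3 E3; lia.
by rewrite inE negb_or => /andP[]; exists a.
Qed.

Lemma cards3 (T : finType) (a b c : T) : uniq [:: a; b; c] -> #|[set a; b; c]| = 3.
Proof.
rewrite /= !inE negb_or andbT => /andP[/andP[ab ac] bc].
by rewrite setUC cardsU1 cards2 !inE negb_or ab eq_sym ac eq_sym bc.
Qed.

(** * Palettes and free colors *)

Section PartialColorings.
Variables (V : finType) (e : rel V).
Hypotheses (e_sym : symmetric e) (e_irr : irreflexive e).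
Implicit Types (A B : {set V}) (S : V -> {set 'I_6}) (c : V -> V -> 'I_6).

Definition nbhd B v := [set u in B | e v u].

(* [S v] has three elements whatever the degree of [v], as if [v] had pendant
   edges up to degree 3; for [v] in [B], the values [c u v] off the edges of [B]
   are irrelevant. *)
Record coloring B S c : Prop := Coloring {
  col_card : forall v, v \in B -> #|S v| = 3;
  col_sym : forall u v, u \in B -> v \in B -> e u v -> c u v = c v u;
  col_mem : forall u v, u \in B -> v \in B -> e u v -> c u v \in S u;
  col_inj : forall v, v \in B -> {in nbhd B v &, injective (c v)};
  col_far : forall u v, u \in B -> v \in B -> e u v ->
    S u :&: S v \subset [set ord0; c u v] }.

Definition colorable B := exists S c, coloring B S c.

Definition free B S c v := S v :\: [set c v u | u in nbhd B v].

Lemma coloring_sub A B S c : A \subset B -> coloring B S c -> coloring A S c.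
Proof.
move=> /subsetP AB [h1 h2 h3 h4 h5]; split=> *; try by (apply: h1 || apply: h2 || apply: h3 || apply: h5); auto.
move=> u v; rewrite !inE => /andP[/AB uB eu] /andP[/AB vB ev].
by apply: h4; rewrite ?inE ?uB ?vB //; auto.
Qed.

Lemma colorable_sub A B : A \subset B -> colorable B -> colorable A.
Proof. by move=> AB [S [c /(coloring_sub AB)]]; exists S, c. Qed.

Lemma freeS B S c v a : a \in free B S c v -> a \in S v.
Proof. by rewrite inE => /andP[]. Qed.

Lemma freeP B S c v a : reflect (a \in S v /\ forall u, u \in B -> e v u -> c v u != a)
                                (a \in free B S c v).
Proof.
rewrite inE; apply: (iffP andP) => [[na aS]|[aS na]]; split=> //.
  by move=> u uB eu; apply: contraNneq na => <-; rewrite imset_f // inE uB.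
by apply/imsetP => -[u]; rewrite inE => /andP[uB eu] ca; move: (na u uB eu); rewrite ca eqxx.
Qed.

Lemma free_exists B S c v :
  coloring B S c -> v \in B -> #|nbhd B v| < 3 -> exists a, a \in free B S c v.
Proof.
move=> col vB d3; apply/card_gt0P; rewrite cardsD subn_gt0 (col_card col vB).
apply: leq_ltn_trans d3; apply: leq_trans (leq_imset_card (c v) _).
exact/subset_leq_card/subsetIr.
Qed.

(* A free color can be exchanged for the color 0, which never conflicts with
   edges at distance 2. *)
Lemma coloring_normalize B S c :
  coloring B S c ->
  exists S', coloring B S' c /\
    forall v a, v \in B -> a \in free B S' c v -> ord0 \in S' v.
Proof.
move=> col.
pose q v := if ord0 \in S v then None else [pick a in free B S c v].
pose S' v := if q v is Some a then ord0 |: (S v :\ a) else S v.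
have S'E v : S' v = S v \/ exists2 a, a \in free B S c v &
     ord0 \notin S v /\ S' v = ord0 |: (S v :\ a).
  rewrite /S' /q; case: ifPn => S0; first by left.
  by case: pickP => [a aF|_]; [right; exists a | left].
have S'S v : S' v \subset ord0 |: S v.
  case: (S'E v) => [->|[a _ [_ ->]]]; first exact: subsetUr.
  by rewrite setUS // subD1set.
exists S'; split; last first.
  move=> v a vB /freeP[]; rewrite /S' /q; case: ifPn => // S0.
  case: pickP => [b bF|noF] aS na; first by rewrite setU11.
  by have := noF a; rewrite /= (introT (freeP _ _ _ _ _)).
split; [|exact: (col_sym col)| |exact: col_inj col|].
- move=> v vB; case: (S'E v) => [->|[a aF [S0 ->]]]; first exact: (col_card col vB).
  rewrite cardsU1 !inE (negPf S0) andbF add1n.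
  by have := cardsD1 a (S v); rewrite (freeS aF) (col_card col vB); lia.
- move=> u v uB vB euv; case: (S'E u) => [->|[a /freeP[aS na] [S0 ->]]].
    exact: (col_mem col).
  by rewrite !inE na // (col_mem col) // orbT.
- move=> u v uB vB euv; apply/subsetP => a; rewrite inE => /andP[au' av'].
  have := subsetP (S'S v) a av'; have := subsetP (S'S u) a au'.
  rewrite !inE; case: (altP (a =P ord0)) => //= a0 au av.
  by have /subsetP/(_ a) := col_far col uB vB euv; rewrite !inE au av (negPf a0) => /(_ isT).
Qed.

(** * Extending a coloring by a vertex or a short path *)

Definition extS S x (T : {set 'I_6}) v := if v == x then T else S v.
Definition extc c x (k : V -> 'I_6) u v :=
  if u == x then k v else if v == x then k u else c u v.

(** The palettes on [B] are kept, so nothing changes between old vertices; a new edge at [u] takes a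
    color of [S u] that no edge uses yet. *)
Lemma coloring_add B S c x (T : {set 'I_6}) (k : V -> 'I_6) :
    coloring B S c -> x \notin B -> #|T| = 3 ->
    (forall u, u \in B -> e x u ->
       [/\ k u \in T, k u \in free B S c u & T :&: S u \subset [set ord0; k u]]) ->
    {in nbhd B x &, injective k} ->
  coloring (x |: B) (extS S x T) (extc c x k).
Proof.
move=> col xB T3 kP kinj.
have nx u : u \in B -> (u == x) = false by move=> uB; apply: contraNF xB => /eqP <-.
split.
- by move=> v; rewrite /extS !inE; case: eqP => //= _; exact: (col_card col).
- move=> u v; rewrite /extc !inE; case: (altP (u =P x)) => [->|] /=; case: (altP (v =P x)) => [->|] //= _ _.
  exact: (col_sym col).
- move=> u v; rewrite /extS /extc !inE; case: (altP (u =P x)) => [->|] /=; case: (altP (v =P x)) => [->|] //= nv.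
  + by rewrite e_irr.
  + by move=> _ vB exv; case: (kP v vB exv).
  + by rewrite e_sym => uB _ exu; case: (kP u uB exu) => _ /freeS.
  + move=> _; exact: (col_mem col).
- move=> v; rewrite !inE; case: (altP (v =P x)) => [->|nv] /= vB u w; rewrite !inE /extc ?eqxx ?(negPf nv).
    case: (altP (u =P x)) => [->|_] /=; first by rewrite e_irr.
    case: (altP (w =P x)) => [->|_] /=; first by rewrite e_irr.
    by move=> ux wx; apply: kinj; rewrite inE.
  case: (altP (u =P x)) => [->|nu] /=; case: (altP (w =P x)) => [->|nw] //=.
  + rewrite e_sym => exv /andP[wB evw] kc; case: (kP v vB exv) => _ /freeP[_ /(_ w wB evw)].
    by rewrite kc eqxx.
  + move=> /andP[wB evw]; rewrite e_sym => exv kc; case: (kP v vB exv) => _ /freeP[_ /(_ u wB evw)].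
    by rewrite kc eqxx.
  + by move=> ux wx; apply: (col_inj col vB); rewrite inE.
- move=> u v; rewrite /extS /extc !inE; case: (altP (u =P x)) => [->|] /=; case: (altP (v =P x)) => [->|] //= nv.
  + by rewrite e_irr.
  + by move=> _ vB exv; case: (kP v vB exv).
  + by rewrite e_sym setIC => uB _ exu; case: (kP u uB exu).
  + move=> _; exact: (col_far col).
Qed.

Lemma free_add_old B S c x T k v a :
    x \notin B -> v \in B -> a \in free B S c v -> (e x v -> k v != a) ->
  a \in free (x |: B) (extS S x T) (extc c x k) v.
Proof.
move=> xB vB /freeP[aS na] ka; have nx : (v == x) = false by apply: contraNF xB => /eqP <-.
apply/freeP; rewrite /extS /extc nx; split=> // u; rewrite !inE.
by case: (altP (u =P x)) => [-> _|_ /= uB]; [rewrite e_sym | exact: na].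
Qed.

Lemma free_add_new B S c x (T : {set 'I_6}) k a :
    a \in T -> (forall u, u \in B -> e x u -> k u != a) ->
  a \in free (x |: B) (extS S x T) (extc c x k) x.
Proof.
move=> aT ka; apply/freeP; rewrite /extS /extc eqxx; split=> // u; rewrite !inE.
by case: eqP => [->|_ /= uB]; [rewrite e_irr | exact: ka].
Qed.

(* On the vertices of [B], only [f] at [u] and [g] at [w] cease to be free. *)
Definition extends B S c u f w g B' S' c' :=
  [/\ coloring B' S' c', forall v, v \in B -> S' v = S v &
      forall v a, v \in B -> a \in free B S c v ->
        (v = u -> a != f) -> (v = w -> a != g) -> a \in free B' S' c' v].

(** The new palette may meet [S u] only in 0 and [f], whence the conditions on [p] and [q]. These
    two remain free for edges added at [x] later. *)
Lemma coloring_add_leaf B S c x u f p q :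
    coloring B S c -> x \notin B -> u \in B -> e x u ->
    (forall z, z \in B -> e x z -> z = u) ->
    f \in free B S c u -> uniq [:: f; p; q] ->
    (p = ord0 \/ p \notin S u) -> (q = ord0 \/ q \notin S u) ->
  exists S' c', [/\ extends B S c u f u f (x |: B) S' c',
    S' x = [set f; p; q], p \in free (x |: B) S' c' x & q \in free (x |: B) S' c' x].
Proof.
move=> col xB uB exu xP fF fpq pS qS.
have nxB v : v \in B -> (v == x) = false by move=> vB; apply: contraNF xB => /eqP <-.
exists (extS S x [set f; p; q]), (extc c x (fun=> f)).
have [fp fq] : f != p /\ f != q by move: fpq; rewrite /= !inE negb_or => /andP[/andP[]].
split; last 3 first.
- by rewrite /extS eqxx.
- by apply: free_add_new => //; rewrite !inE eqxx ?orbT.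
- by apply: free_add_new => //; rewrite !inE eqxx ?orbT.
split.
- apply: coloring_add => //; first exact: cards3.
    move=> z zB /(xP _ zB)->; split=> //; first by rewrite !inE eqxx.
    apply/subsetP => a; rewrite !inE -orbA => /andP[/or3P[]/eqP-> //]; rewrite ?eqxx ?orbT //.
      by case: pS => [->|/negPf->] //; rewrite eqxx.
    by case: qS => [->|/negPf->] //; rewrite eqxx.
  by move=> y z; rewrite !inE => /andP[/xP yB /yB->] /andP[/xP zB /zB->].
- by move=> v vB; rewrite /extS nxB.
- move=> v a vB aF au _; apply: free_add_old => // /(xP _ vB) vu.
  by rewrite eq_sym au.
Qed.

(** The third color of [x] has to avoid both end palettes, which is possible as both contain 0. The
    last two conditions keep [f] and [g] out of the opposite palette. *)
Lemma coloring_add_mid B S c x u f w g :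
    coloring B S c -> x \notin B -> u \in B -> w \in B -> u != w -> e x u -> e x w ->
    (forall z, z \in B -> e x z -> z = u \/ z = w) ->
    f \in free B S c u -> g \in free B S c w -> ord0 \in S u -> ord0 \in S w ->
    f != g -> (f = ord0 \/ f \notin S w) -> (g = ord0 \/ g \notin S u) ->
  exists S' c', extends B S c u f w g (x |: B) S' c'.
Proof.
move=> col xB uB wB uw exu exw xP fF gF u0 w0 fg fS gS.
have nxB v : v \in B -> (v == x) = false by move=> vB; apply: contraNF xB => /eqP <-.
have [p pu pw] := color_avoiding_two (col_card col uB) (col_card col wB) u0 w0.
pose k v := if v == u then f else g.
have ku : k u = f by rewrite /k eqxx.
have kw : k w = g by rewrite /k eq_sym (negPf uw).
exists (extS S x [set f; g; p]), (extc c x k); split.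
- apply: coloring_add => //.
  + apply: cards3; rewrite /= !inE negb_or fg !andbT; apply/andP; split.
      by apply: contraNneq pu => <-; exact: (freeS fF).
    by apply: contraNneq pw => <-; exact: (freeS gF).
  + move=> z zB /(xP _ zB)[]->; rewrite ?ku ?kw; (split; [by rewrite !inE eqxx ?orbT | by [] | ]).
    * apply/subsetP => a; rewrite !inE -orbA => /andP[/or3P[]/eqP-> //]; rewrite ?eqxx ?orbT //.
        by case: gS => [->|/negPf->] //; rewrite eqxx.
      by rewrite (negPf pu).
    * apply/subsetP => a; rewrite !inE -orbA => /andP[/or3P[]/eqP-> //]; rewrite ?eqxx ?orbT //.
        by case: fS => [->|/negPf->] //; rewrite eqxx.
      by rewrite (negPf pw).
  + move=> y z; rewrite !inE => /andP[/xP yB /yB yE] /andP[/xP zB /zB zE].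
    by case: yE zE => -> [] -> //; rewrite ku kw => /eqP; rewrite ?(negPf fg) // eq_sym (negPf fg).
- by move=> v vB; rewrite /extS nxB.
- move=> v a vB aF au aw; apply: free_add_old => // /(xP _ vB)[] vE.
    by rewrite vE ku eq_sym au.
  by rewrite vE kw eq_sym aw.
Qed.

Lemma coloring_add_path B S c x y u f w g :
    coloring B S c -> x \notin B -> y \notin B -> x != y ->
    u \in B -> w \in B -> u != w -> e x u -> e x y -> e y w ->
    (forall z, z \in B -> e x z -> z = u) ->
    (forall z, z \in B -> e y z -> z = w) ->
    f \in free B S c u -> g \in free B S c w -> ord0 \in S u -> ord0 \in S w ->
    (g = ord0 \/ f != g) ->
  exists S' c', extends B S c u f w g (y |: (x |: B)) S' c'.
Proof.
move=> col xB yB xy uB wB uw exu exy eyw xP yP fF gF u0 w0 fg.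
have [Su3 Sw3] := (col_card col uB, col_card col wB).
have fu := freeS fF; have gw := freeS gF.
(* These are the requirements of the two extensions; 0 in the palette of [x] secures a third color
   at [y]. *)
suff [m [p [fmp mS pS mg [mw [g0 T0]]]]] : exists m p, [/\ uniq [:: f; m; p],
      m = ord0 \/ m \notin S u, p = ord0 \/ p \notin S u, m != g
    & (m = ord0 \/ m \notin S w) /\ (g = ord0 \/ g \notin [set f; m; p])
      /\ ord0 \in [set f; m; p]].
  have [S1 [c1 [[col1 S1E F1] S1x mF pF]]] := coloring_add_leaf col xB uB exu xP fF fmp mS pS.
  have nx v : v \in B -> v != x by move=> vB; apply: contraNneq xB => <-.
  have [|||||||||||S2 [c2 [col2 S2E F2]]] :=
    @coloring_add_mid _ _ _ y x m w g col1 _ _ _ _ _ eyw _ mF _ _ _ mg.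
  - by rewrite !inE eq_sym negb_or xy.
  - by rewrite setU11.
  - by rewrite inE wB orbT.
  - by rewrite eq_sym nx.
  - by rewrite e_sym.
  - by move=> z; rewrite !inE => /orP[/eqP->|zB /(yP _ zB)]; [left | right].
  - by apply: F1 => // wu; rewrite wu eqxx in uw.
  - by rewrite S1x.
  - by rewrite S1E.
  - by rewrite S1E.
  - by rewrite S1x.
  exists S2, c2; split=> //.
    by move=> v vB; rewrite S2E ?S1E // inE vB orbT.
  move=> v a vB aF au aw; apply: F2 => //.
  - by rewrite inE vB orbT.
  - exact: F1.
  - by move=> vx; have := nx v vB; rewrite vx eqxx.
(* If [f] and [g] are both nonzero, the middle edge gets [m = 0]. Otherwise [m] avoids both end
   palettes, and 0 is in the palette of [x] as [f] or as [p]. *)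
case: (eqVneq f ord0) => [f0|f0].
- have [m mu mw] := color_avoiding_two Su3 Sw3 u0 w0.
  have [|p pu] := @color_avoiding_cons (S u) [:: m; g]; first by rewrite Su3.
  rewrite !inE negb_or => /andP[pm pg].
  have gm : g != m by apply: contraNneq mw => <-.
  exists m, p; split; try by right.
  + rewrite /= !inE negb_or andbT (eq_sym m) pm !andbT.
    by apply/andP; split; [apply: contraNneq mu => <- | apply: contraNneq pu => <-].
  + by rewrite eq_sym.
  + split; first by right.
    split; last by rewrite !inE f0 eqxx.
    case: fg => [|fg]; [by left | right].
    by rewrite !inE !negb_or eq_sym fg gm eq_sym pg.
- case: (eqVneq g ord0) => [g0|g0].
  + have [m mu mw] := color_avoiding_two Su3 Sw3 u0 w0.
    exists m, ord0; split; try by [left | right].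
    * rewrite /= !inE negb_or f0 !andbT.
      by apply/andP; split; [apply: contraNneq mu => <- | apply: contraNneq mw => ->].
    * by rewrite g0; apply: contraNneq mw => ->.
    * by split; [right | split; [left | rewrite !inE eqxx orbT]].
  + have [|p pu] := @color_avoiding_cons (S u) [:: g]; first by rewrite Su3.
    rewrite !inE => pg.
    exists ord0, p; split; try by [left | right].
    * rewrite /= !inE negb_or f0 !andbT.
      by apply/andP; split; [apply: contraNneq pu => <- | apply: contraNneq pu => <-].
    * by rewrite eq_sym.
    * split; first by left.
      split; last by rewrite !inE eqxx orbT.
      right; rewrite !inE !negb_or (negPf g0) eq_sym (eq_sym g) pg !andbT.
      by case: fg => [/eqP|]; rewrite ?(negPf g0).
Qed.

Lemma nbhd_only A B x u y :
  nbhd A x = [set u; y] -> B \subset A -> y \notin B ->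
  forall z, z \in B -> e x z -> z = u.
Proof.
move=> Nx /subsetP BA yB z zB exz; have: z \in nbhd A x by rewrite inE BA.
by rewrite Nx !inE => /orP[/eqP//|/eqP zy]; rewrite -zy zB in yB.
Qed.

Fixpoint non_backtracking (s : seq V) :=
  if s is a :: s' then (if s' is _ :: c :: _ then a != c else true) && non_backtracking s'
  else true.

(** * Reducible configurations in a minimal uncolorable set *)

Section MinimalUncolorable.
Hypothesis girth : forall s, uniq s -> cycle e s -> 2 < size s -> 6 < size s.

(** A repeated vertex would close a walk of length at most 6: length 1 is a loop, length 2 a
    backtrack, and anything longer a cycle below the girth. This makes all vertices of a
    configuration distinct. *)
Lemma non_backtracking_uniq a p :
  path e a p -> non_backtracking (a :: p) -> size p <= 6 -> uniq (a :: p).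
Proof.
elim: p a => [|b p IH] // a ep nb sp.
have Ubp : uniq (b :: p).
  by apply: IH; [case/andP: ep | case/andP: nb | exact: ltnW].
rewrite cons_uniq Ubp andbT; apply/negP => ap.
have [p1 [p2 pE]] : exists p1 p2, b :: p = p1 ++ a :: p2.
  by case/splitPr: ap => p1 p2; exists p1, p2.
move: ep Ubp sp nb; rewrite pE => ep Ubp sp nb.
have Up1 : uniq (a :: p1).
  move: Ubp; rewrite cat_uniq /= negb_or => /and3P[-> /andP[-> _] _] //.
have cp1 : cycle e (a :: p1).
  by move: ep; rewrite cat_path /= rcons_path => /and3P[-> ->].
have s1 : size p1 <= 5 by move: sp; rewrite size_cat /=; lia.
case: p1 pE ep Ubp sp nb Up1 cp1 s1 => [|b1 [|b2 p1]] /=.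
- by move=> _; rewrite e_irr.
- by move=> _ _ _ _; rewrite eqxx.
- by move=> _ _ _ _ _ Up1 cp1 s1; have := @girth [:: a, b1, b2 & p1] Up1 cp1 isT; rewrite /=; lia.
Qed.

Variable A : {set V}.
Hypotheses (A_uncol : ~ colorable A)
  (A_min : forall B, B \proper A -> colorable B)
  (A_cubic : forall v, v \in A -> #|nbhd A v| <= 3).

(** A remaining vertex adjacent to [X] has at most two neighbors left, so one of its three colors is
    free, and normalization then puts 0 in its palette. *)
Lemma coloring_off (X : {set V}) x : x \in A -> x \in X ->
  exists S c, coloring (A :\: X) S c /\
    forall w y, w \in A :\: X -> y \in X -> y \in A -> e w y ->
      exists2 f, f \in free (A :\: X) S c w & ord0 \in S w.
Proof.
move=> xA xX; have /A_min[S0 [c /coloring_normalize[S [col S0P]]]] : A :\: X \proper A.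
  apply/properP; split; first exact: subsetDl.
  by exists x; rewrite // inE xX.
exists S, c; split=> // w y wX yX yA ewy.
have wA : w \in A by move: wX; rewrite inE => /andP[].
have [|f fF] := free_exists col wX; last by exists f => //; apply: S0P fF.
apply: leq_trans (A_cubic wA); apply/proper_card/properP; split.
  by apply/subsetP => z; rewrite !inE => /andP[/andP[_ ->]].
by exists y; rewrite !inE ?yX // yA.
Qed.

Lemma cover_colorable B S c : A \subset B -> ~ coloring B S c.
Proof. by move=> AB col; apply: A_uncol; apply: colorable_sub AB _; exists S, c. Qed.

Lemma min_degree x : x \in A -> 1 < #|nbhd A x|.
Proof.
move=> xA; rewrite ltnNge; apply/negP => d1.
have [S [c [col F]]] := coloring_off xA (set11 x).
have xB : x \notin A :\ x by rewrite !inE eqxx.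
have AB : A \subset x |: (A :\ x) by rewrite setD1K.
case: (set_0Vmem (nbhd A x)) => [N0|[u uN]].
  (* Without neighbors any three colors form a valid palette, and the edge colors are dummies. *)
  apply: (cover_colorable AB (coloring_add (T := [set ord0; inord 1; inord 2]) (k := fun=> ord0) col xB _ _ _)).
  - by rewrite cards3 //= !inE -!val_eqE /= !inordK.
  - move=> u; rewrite !inE => /andP[_ uA] exu.
    have uN : u \in nbhd A x by rewrite inE uA.
    by rewrite N0 inE in uN.
  - move=> y z; rewrite !inE => /andP[/andP[_ yA] exy].
    have yN : y \in nbhd A x by rewrite inE yA.
    by rewrite N0 inE in yN.
have uP z : z \in A :\ x -> e x z -> z = u.
  rewrite !inE => /andP[_ zA] exz; apply/eqP; apply: contraTT d1 => zu.
  rewrite -ltnNge; apply: (@leq_trans #|[set z; u]|); first by rewrite cards2 zu.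
  by apply: subset_leq_card; apply/subsetP => y; rewrite !inE => /orP[]/eqP->; rewrite ?zA //; move: uN; rewrite inE.
move: uN; rewrite inE => /andP[uA exu].
have uB : u \in A :\ x by rewrite !inE uA andbT; apply: contraTneq exu => ->; rewrite e_irr.
have [|f fF u0] := F u x uB (set11 x) xA; first by rewrite e_sym.
have Su3 := col_card col uB.
have [|p pu _] := @color_avoiding_cons (S u) [::]; first by rewrite Su3.
have [|q qu] := @color_avoiding_cons (S u) [:: p]; first by rewrite Su3.
rewrite inE => qp.
have [||| S' [c' [[col' _ _] _ _ _]]] := coloring_add_leaf (p := p) (q := q) col xB uB exu uP fF.
- rewrite /= !inE negb_or andbT (eq_sym p) qp andbT.
  by apply/andP; split; [apply: contraNneq pu => <- | apply: contraNneq qu => <-]; exact: (freeS fF).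
- by right.
- by right.
exact: (cover_colorable AB col').
Qed.

Lemma deg2_other x u : u \in A -> e x u -> #|nbhd A x| = 2 ->
  exists y, [/\ nbhd A x = [set u; y], u != y, y \in A & e x y].
Proof.
move=> uA exu /eqP d2; have [a [b [ab Nx]]] := cards2P _ d2.
have [[aA bA] [ea eb]] : (a \in A /\ b \in A) /\ (e x a /\ e x b).
  by have := set21 a b; have := set22 a b; rewrite -Nx !inE => /andP[-> ->] /andP[-> ->].
have uN : u \in nbhd A x by rewrite inE uA.
rewrite Nx !inE in uN; case/orP: uN => /eqP ->; first by exists b; split.
by exists a; split=> //; [rewrite setUC | rewrite eq_sym].
Qed.

Lemma nbhd_eq x (D : {set V}) : x \in A -> D \subset nbhd A x -> #|nbhd A x| <= #|D| ->
  nbhd A x = D.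
Proof. by move=> xA DN ND; apply/esym/eqP; rewrite eqEcard DN. Qed.

Lemma nbhd_two x u w : x \in A -> u \in A -> w \in A -> e x u -> e x w -> u != w ->
  #|nbhd A x| = 2 -> nbhd A x = [set u; w].
Proof.
move=> xA uA wA exu exw uw d2; apply: nbhd_eq => //; last by rewrite d2 cards2 uw.
by apply/subsetP => z; rewrite !inE => /orP[]/eqP->; rewrite ?uA ?wA.
Qed.

(** Meant for a vertex attached as a leaf to palette [D] by an edge of color [f]: [p] and [q] start
    two paths from it whose far ends have the free colors [r] and [s], and the last conditions are
    the one in [coloring_add_path]. At most five colors must be avoided at a time. *)
Lemma leaf_colors (D : {set 'I_6}) (f r s : 'I_6) :
    #|D| = 3 -> f \in D -> ord0 \in D ->
  exists p q, [/\ uniq [:: f; p; q], p = ord0 \/ p \notin D, q = ord0 \/ q \notin D,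
    ord0 \in [set f; p; q] & (r = ord0 \/ p != r) /\ (s = ord0 \/ q != s)].
Proof.
move=> D3 fD D0.
have nf p : p \notin D -> f != p by apply: contraNneq => <-.
have [f0|f0] := eqVneq f ord0.
  have [|p pD] := @color_avoiding_cons D [:: r]; first by rewrite D3.
  rewrite inE => pr.
  have [|q qD] := @color_avoiding_cons D [:: p; s]; first by rewrite D3.
  rewrite !inE negb_or => /andP[qp qs].
  exists p, q; split; try by right.
  - by rewrite /= !inE negb_or !nf // eq_sym qp.
  - by rewrite f0 !inE eqxx.
  - by split; right.
have [|q qD] := @color_avoiding_cons D [:: s]; first by rewrite D3.
rewrite inE => qs.
exists ord0, q; split; try by [left | right].
- by rewrite /= !inE negb_or f0 nf //=; rewrite andbT; apply: contraNneq qD => <-.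
- by rewrite !inE eqxx orbT.
- split; last by right.
  by have [->|] := eqVneq r ord0; [left | rewrite eq_sym; right].
Qed.

Ltac split_uniq U := move: U; rewrite /= !inE !negb_or -!andbA;
  repeat match goal with |- is_true (andb _ _) -> _ => case/andP=> ? end; try move=> _.

Ltac neqs := repeat match goal with
  | H : is_true (?a != ?b) |- context [?a == ?b] => rewrite (negPf H)
  | H : is_true (?a != ?b) |- context [?b == ?a] => rewrite (eq_sym b a) (negPf H)
  end.

(* [p], [q] and [r] are the colors at a vertex of degree 3 of the edges towards,
   respectively, a path with two inner vertices ending in the free color [f], and
   two paths with one inner vertex ending at vertices with color sets [D] and [E]
   in the free colors [g] and [h]. *)
Lemma branch_colors (D E : {set 'I_6}) (f g h : 'I_6) :
    #|D| = 3 -> #|E| = 3 -> ord0 \in D -> ord0 \in E -> g \in D -> h \in E ->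
  exists p q r, [/\ uniq [:: p; q; r], ord0 \in [set p; q; r], f = ord0 \/ p != f,
    [/\ q != g, q = ord0 \/ q \notin D & g = ord0 \/ g \notin [set p; q; r]] &
    [/\ r != h, r = ord0 \/ r \notin E & h = ord0 \/ h \notin [set p; q; r]]].
Proof.
move=> D3 E3 D0 E0 gD hE.
have nD x : x \notin D -> [/\ x != ord0, x != g & x \notin D].
  by move=> xD; split=> //; apply: contraNneq xD => ->.
have nE x : x \notin E -> [/\ x != ord0, x != h & x \notin E].
  by move=> xE; split=> //; apply: contraNneq xE => ->.
(* If [g] and [h] are both 0, the matching color goes to the long path. Otherwise it goes to a short
   path whose end color is nonzero, and [p] is chosen last; when neither is 0, [p] has exactly five
   colors to avoid. *)
have [g0|g0] := eqVneq g ord0; have [h0|h0] := eqVneq h ord0.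
- have [|q /nD[q0 _ qD] _] := @color_avoiding_cons D [::]; first by rewrite D3.
  have [|r /nE[r0 _ rE]] := @color_avoiding_cons E [:: q]; first by rewrite E3.
  rewrite inE => rq; exists ord0, q, r; rewrite g0 h0 q0 r0.
  split; try by split; auto.
  + by rewrite /= !inE negb_or ![ord0 == _]eq_sym q0 r0 eq_sym rq.
  + by rewrite !inE eqxx.
  + by have [|] := eqVneq f ord0; rewrite 1?eq_sym; auto.
- have [|q /nD[q0 _ qD]] := @color_avoiding_cons D [:: h]; first by rewrite D3.
  rewrite inE => qh.
  have [|p _] := @color_avoiding_cons set0 [:: ord0; f; h; q]; first by rewrite cards0.
  rewrite !inE !negb_or => /and4P[p0 pf ph pq].
  exists p, q, ord0; rewrite g0 q0; split; try by split; auto.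
  + by rewrite /= !inE negb_or pq p0 q0.
  + by rewrite !inE eqxx orbT.
  + by right.
  + split; rewrite 1?eq_sym //; first by left.
    by right; rewrite !inE !negb_or (eq_sym h p) ph (eq_sym h q) qh h0.
- have [|r /nE[r0 _ rE]] := @color_avoiding_cons E [:: g]; first by rewrite E3.
  rewrite inE => rg.
  have [|p _] := @color_avoiding_cons set0 [:: ord0; f; g; r]; first by rewrite cards0.
  rewrite !inE !negb_or => /and4P[p0 pf pg pr].
  exists p, ord0, r; rewrite h0 r0; split; try by split; auto.
  + by rewrite /= !inE negb_or pr p0 eq_sym r0.
  + by rewrite !inE eqxx orbT.
  + by right.
  + split; rewrite 1?eq_sym //; first by left.
    by right; rewrite !inE !negb_or (eq_sym g p) pg g0 (eq_sym g r) rg.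
- have [|r /nE[r0 rh rE]] := @color_avoiding_cons E [:: g]; first by rewrite E3.
  rewrite inE => rg.
  have [|p _] := @color_avoiding_cons set0 [:: ord0; f; g; h; r]; first by rewrite cards0.
  rewrite !inE !negb_or => /and5P[p0 pf pg ph pr].
  exists p, ord0, r; split.
  + by rewrite /= !inE negb_or pr p0 eq_sym r0.
  + by rewrite !inE eqxx orbT.
  + by right.
  + split; rewrite 1?eq_sym //; first by left.
    by right; rewrite !inE !negb_or (eq_sym g p) pg g0 (eq_sym g r) rg.
  + split=> //; first by right.
    by right; rewrite !inE !negb_or (eq_sym h p) ph h0 (eq_sym h r) rh.
Qed.

Ltac by_neqs := by let H := fresh in move=> H; exfalso; move/eqP: H; neqs.

Lemma add_mid_in B S c x u f w g :
    coloring B S c -> B \subset A -> x \notin B -> u \in B -> w \in B -> u != w ->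
    nbhd A x = [set u; w] ->
    f \in free B S c u -> g \in free B S c w -> ord0 \in S u -> ord0 \in S w ->
    f != g -> (f = ord0 \/ f \notin S w) -> (g = ord0 \/ g \notin S u) ->
  exists S' c', extends B S c u f w g (x |: B) S' c'.
Proof.
move=> col /subsetP BA xB uB wB uw Nx.
have /setIdP[_ exu] : u \in nbhd A x by rewrite Nx set21.
have /setIdP[_ exw] : w \in nbhd A x by rewrite Nx set22.
apply: (coloring_add_mid col xB uB wB uw exu exw) => z zB exz.
have : z \in nbhd A x by rewrite inE BA.
by rewrite Nx !inE => /orP[]/eqP; [left | right].
Qed.

Lemma add_path_in B S c x y u f w g :
    coloring B S c -> B \subset A -> x \notin B -> y \notin B ->
    u \in B -> w \in B -> u != w ->
    nbhd A x = [set u; y] -> nbhd A y = [set w; x] ->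
    f \in free B S c u -> g \in free B S c w -> ord0 \in S u -> ord0 \in S w ->
    (g = ord0 \/ f != g) ->
  exists S' c', extends B S c u f w g (y |: (x |: B)) S' c'.
Proof.
move=> col BA xB yB uB wB uw Nx Ny.
have /setIdP[_ exu] : u \in nbhd A x by rewrite Nx set21.
have /setIdP[_ exy] : y \in nbhd A x by rewrite Nx set22.
have /setIdP[_ eyw] : w \in nbhd A y by rewrite Ny set21.
have xy : x != y by apply: contraTneq exy => ->; rewrite e_irr.
by apply: coloring_add_path => //; [apply: nbhd_only Nx BA yB | apply: nbhd_only Ny BA xB].
Qed.

(** With the thread removed, [x3] is put back as a leaf at its outer neighbor, and [x2], [x1] as a
    path from [x3] to the other end. *)
Lemma no_three_thread x1 x2 x3 :
    x1 \in A -> x2 \in A -> x3 \in A -> e x1 x2 -> e x2 x3 -> x1 != x3 ->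
    #|nbhd A x1| = 2 -> #|nbhd A x2| = 2 -> #|nbhd A x3| = 2 -> False.
Proof.
move=> x1A x2A x3A e12 e23 x13 d1 d2 d3.
have [w [N1 x2w wA e1w]] := deg2_other x2A e12 d1.
have [w' [N3 x2w' w'A e3w']] : exists y, [/\ nbhd A x3 = [set x2; y], x2 != y, y \in A & e x3 y].
  by apply: deg2_other => //; rewrite e_sym.
have N2 : nbhd A x2 = [set x3; x1].
  by apply: nbhd_two => //; [rewrite e_sym | rewrite eq_sym].
have U : uniq [:: w; x1; x2; x3; w'].
  apply: non_backtracking_uniq => //=; first by rewrite e_sym e1w e12 e23 e3w'.
  by rewrite eq_sym x2w x13 x2w'.
split_uniq U.
pose X := [set x1; x2; x3].
have x2X : x2 \in X by rewrite !inE eqxx orbT.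
have [S [c [col F]]] := coloring_off x2A x2X.
have wB : w \in A :\: X by rewrite !inE wA; neqs.
have w'B : w' \in A :\: X by rewrite !inE w'A; neqs.
have [||f fF w0] := F w x1 wB _ x1A; [by rewrite !inE eqxx | by rewrite e_sym |].
have [||g gF w'0] := F w' x3 w'B _ x3A; [by rewrite !inE eqxx !orbT | by rewrite e_sym |].
have [p [q [Ugpq pS qS pq0 [pf _]]]] := leaf_colors f f (col_card col w'B) (freeS gF) w'0.
have x3B : x3 \notin A :\: X by rewrite !inE eqxx !orbT.
have only3 : forall z, z \in A :\: X -> e x3 z -> z = w'.
  by rewrite setUC in N3; apply: nbhd_only N3 (subsetDl _ _) _; rewrite inE x2X.
have [S1 [c1 [[col1 S1E F1] S1x pF _]]] := coloring_add_leaf col x3B w'B e3w' only3 gF Ugpq pS qS.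
have BA : x3 |: A :\: X \subset A by rewrite subUset sub1set x3A subsetDl.
have [|||||||||||S2 [c2 [col2 _ _]]] := @add_path_in _ _ _ x2 x1 x3 p w f col1 BA _ _ _ _ _ _ _ pF.
- by rewrite !inE; neqs; rewrite eqxx ?orbT.
- by rewrite !inE; neqs; rewrite eqxx ?orbT.
- exact: setU11.
- by rewrite inE wB orbT.
- by rewrite eq_sym.
- exact: N2.
- by rewrite setUC.
- by apply: F1 => //; by_neqs.
- by rewrite S1x.
- by rewrite S1E.
- by [].
apply: (cover_colorable _ col2).
apply/subsetP => z zA; rewrite !inE zA.
by case: (z == x1); case: (z == x2); case: (z == x3).
Qed.

(** [v] is put back as a leaf at [t]. Its palette has two further colors, one to start each thread,
    which [leaf_colors] adapts to the free colors at the far ends. *)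
Lemma no_two_long_threads v t x1 x2 y1 y2 :
    v \in A -> t \in A -> x1 \in A -> x2 \in A -> y1 \in A -> y2 \in A ->
    e v t -> e v x1 -> e v y1 -> e x1 x2 -> e y1 y2 ->
    t != x1 -> t != y1 -> x1 != y1 -> v != x2 -> v != y2 ->
    #|nbhd A x1| = 2 -> #|nbhd A x2| = 2 -> #|nbhd A y1| = 2 -> #|nbhd A y2| = 2 ->
  False.
Proof.
move=> vA tA x1A x2A y1A y2A evt evx evy ex ey tx ty xy vx vy dx1 dx2 dy1 dy2.
have [exv eyv] : e x1 v /\ e y1 v by rewrite -!(e_sym v).
have [ex' ey'] : e x2 x1 /\ e y2 y1 by rewrite (e_sym x2) (e_sym y2).
have Nx1 := nbhd_two x1A vA x2A exv ex vx dx1.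
have Ny1 := nbhd_two y1A vA y2A eyv ey vy dy1.
have [x [Nx2 x1x xA ex2x]] := deg2_other x1A ex' dx2.
have [y [Ny2 y1y yA ey2y]] := deg2_other y1A ey' dy2.
have Nv : nbhd A v = [set t; x1; y1].
  apply: nbhd_eq => //; last by rewrite cards3 ?A_cubic //= !inE negb_or tx ty xy.
  by apply/subsetP => z; rewrite !inE => /orP[/orP[]|]/eqP->; rewrite ?tA ?x1A ?y1A.
(* Seven vertices: the longest walk to which the girth bound is applied. *)
have U1 : uniq [:: x; x2; x1; v; y1; y2; y].
  apply: non_backtracking_uniq => //=; first by rewrite e_sym ex2x ex' exv evy ey ey2y.
  by rewrite ![_ == x1]eq_sym x1x (eq_sym x2) vx xy vy y1y.
have U2 : uniq [:: t; v; x1; x2; x].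
  apply: non_backtracking_uniq => //=; first by rewrite e_sym evt evx ex ex2x.
  by rewrite tx vx x1x.
have U3 : uniq [:: t; v; y1; y2; y].
  apply: non_backtracking_uniq => //=; first by rewrite e_sym evt evy ey ey2y.
  by rewrite ty vy y1y.
split_uniq U1; split_uniq U2; split_uniq U3.
pose X := [set v; x1; x2; y1; y2].
have vX : v \in X by rewrite !inE eqxx.
have [S [c [col F]]] := coloring_off vA vX.
have tB : t \in A :\: X by rewrite !inE tA; neqs.
have xB : x \in A :\: X by rewrite !inE xA; neqs.
have yB : y \in A :\: X by rewrite !inE yA; neqs.
have [|h hF t0] := F t v tB vX vA; first by rewrite e_sym.
have [||f fF x0] := F x x2 xB _ x2A; [by rewrite !inE eqxx ?orbT | by rewrite e_sym |].
have [||g gF y0] := F y y2 yB _ y2A; [by rewrite !inE eqxx ?orbT | by rewrite e_sym |].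
have [p [q [Uhpq pS qS pq0 [pf qg]]]] := leaf_colors f g (col_card col tB) (freeS hF) t0.
have vB : v \notin A :\: X by rewrite !inE eqxx.
have v_only z : z \in A :\: X -> e v z -> z = t.
  move=> zB evz; have : z \in nbhd A v by move: zB; rewrite !inE evz andbT => /andP[].
  by rewrite Nv !inE => /orP[/orP[]|]/eqP zE //; move: zB; rewrite zE !inE eqxx ?orbT.
have [S1 [c1 [[col1 S1E F1] S1v pF qF]]] := coloring_add_leaf col vB tB evt v_only hF Uhpq pS qS.
have B1A : v |: A :\: X \subset A by rewrite subUset sub1set vA subsetDl.
have [|||||||||||S2 [c2 [col2 S2E F2]]] := @add_path_in _ _ _ x1 x2 v p x f col1 B1A _ _ _ _ _ _ _ pF.
- by rewrite !inE; neqs; rewrite eqxx ?orbT.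
- by rewrite !inE; neqs; rewrite eqxx ?orbT.
- exact: setU11.
- by rewrite inE xB orbT.
- by rewrite eq_sym.
- by [].
- by rewrite setUC.
- by apply: F1 => //; by_neqs.
- by rewrite S1v.
- by rewrite S1E.
- by [].
have B2A : x2 |: (x1 |: (v |: A :\: X)) \subset A.
  by rewrite 2!subUset !sub1set x1A x2A.
have [||||||||||||S3 [c3 [col3 _ _]]] := @add_path_in _ _ _ y1 y2 v q y g col2 B2A.
- by rewrite !inE; neqs; rewrite eqxx ?orbT.
- by rewrite !inE; neqs; rewrite eqxx ?orbT.
- by rewrite !inE eqxx ?orbT.
- by rewrite !inE yA; neqs; rewrite ?orbT.
- by neqs.
- exact: Ny1.
- by rewrite setUC in Ny2; rewrite Ny2 setUC.
- apply: F2 => //; [exact: setU11 | | by_neqs].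
  by move=> _; move: Uhpq => /=; rewrite !inE (eq_sym q) => /and3P[].
- apply: F2; [by rewrite inE yB orbT | | by_neqs | by_neqs].
  by apply: F1 => //; by_neqs.
- by rewrite S2E ?setU11 // S1v.
- by rewrite S2E ?S1E // inE yB orbT.
- by [].
apply: (cover_colorable _ col3).
apply/subsetP => z zA; rewrite !inE zA.
by case: (z == v); case: (z == x1); case: (z == x2); case: (z == y1); case: (z == y2).
Qed.

(** All neighbors of [v] are removed along with it, so its palette can be chosen at will;
    [branch_colors] fits it to the three outer ends at once. *)
Lemma no_long_thread_and_twos v x1 x2 y z :
    v \in A -> x1 \in A -> x2 \in A -> y \in A -> z \in A ->
    e v x1 -> e v y -> e v z -> e x1 x2 ->
    x1 != y -> x1 != z -> y != z -> v != x2 ->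
    #|nbhd A x1| = 2 -> #|nbhd A x2| = 2 -> #|nbhd A y| = 2 -> #|nbhd A z| = 2 ->
  False.
Proof.
move=> vA x1A x2A yA zA evx evy evz ex xy xz yz vx dx1 dx2 dy dz.
have [exv [eyv ezv]] : e x1 v /\ e y v /\ e z v by rewrite -!(e_sym v).
have ex' : e x2 x1 by rewrite e_sym.
have Nx1 := nbhd_two x1A vA x2A exv ex vx dx1.
have [x' [Nx2 x1x' x'A ex2x']] := deg2_other x1A ex' dx2.
have [y' [Ny vy' y'A eyy']] := deg2_other vA eyv dy.
have [z' [Nz vz' z'A ezz']] := deg2_other vA ezv dz.
have Nv : nbhd A v = [set x1; y; z].
  apply: nbhd_eq => //; last by rewrite cards3 ?A_cubic //= !inE negb_or xy xz yz.
  by apply/subsetP => u; rewrite !inE => /orP[/orP[]|]/eqP->; rewrite ?yA ?x1A ?zA.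
have U1 : uniq [:: x'; x2; x1; v; y; y'].
  apply: non_backtracking_uniq => //=; first by rewrite e_sym ex2x' ex' exv evy eyy'.
  by rewrite ![_ == x1]eq_sym x1x' (eq_sym x2) vx xy vy'.
have U2 : uniq [:: x'; x2; x1; v; z; z'].
  apply: non_backtracking_uniq => //=; first by rewrite e_sym ex2x' ex' exv evz ezz'.
  by rewrite ![_ == x1]eq_sym x1x' (eq_sym x2) vx xz vz'.
have U3 : uniq [:: y'; y; v; z; z'].
  apply: non_backtracking_uniq => //=; first by rewrite e_sym eyy' eyv evz ezz'.
  by rewrite eq_sym vy' yz vz'.
split_uniq U1; split_uniq U2; split_uniq U3.
pose X := [set v; x1; x2; y; z].
have vX : v \in X by rewrite !inE eqxx.
have [S [c [col F]]] := coloring_off vA vX.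
have x'B : x' \in A :\: X by rewrite !inE x'A; neqs.
have y'B : y' \in A :\: X by rewrite !inE y'A; neqs.
have z'B : z' \in A :\: X by rewrite !inE z'A; neqs.
have [||f fF x'0] := F x' x2 x'B _ x2A; [by rewrite !inE eqxx ?orbT | by rewrite e_sym |].
have [||g gF y'0] := F y' y y'B _ yA; [by rewrite !inE eqxx ?orbT | by rewrite e_sym |].
have [||h hF z'0] := F z' z z'B _ zA; [by rewrite !inE eqxx ?orbT | by rewrite e_sym |].
have [p [q [r [Upqr T0 pf qP rP]]]] :=
  branch_colors f (col_card col y'B) (col_card col z'B) y'0 z'0 (freeS gF) (freeS hF).
have vB : v \notin A :\: X by rewrite !inE eqxx.
have v_only u : u \in A :\: X -> e v u -> False.
  move=> uB evu; have : u \in nbhd A v by move: uB; rewrite !inE evu andbT => /andP[].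
  by rewrite Nv !inE => /orP[/orP[]|]/eqP uE //; move: uB; rewrite uE !inE eqxx ?orbT.
(* [v] has no neighbor in [A :\: X], so the edge colors supplied here are dummies. *)
pose S1 := extS S v [set p; q; r]; pose c1 := extc c v (fun=> ord0).
have col1 : coloring (v |: A :\: X) S1 c1.
  apply: coloring_add (cards3 Upqr) _ _ => // [u uB /(v_only u uB)[]|u u'].
  by rewrite inE => /andP[uB /(v_only u uB)[]].
have S1v : S1 v = [set p; q; r] by rewrite /S1 /extS eqxx.
have S1E u : u \in A :\: X -> S1 u = S u.
  by rewrite /S1 /extS => uB; case: eqP => // uv; rewrite -uv uB in vB.
have F1 u a : u \in A :\: X -> a \in free (A :\: X) S c u -> a \in free (v |: A :\: X) S1 c1 u.
  by move=> uB aF; apply: free_add_old => // /(v_only u uB).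
have F1v a : a \in [set p; q; r] -> a \in free (v |: A :\: X) S1 c1 v.
  by move=> aF; apply: free_add_new => // u uB /(v_only u uB).
have B1A : v |: A :\: X \subset A by rewrite subUset sub1set vA subsetDl.
case: qP => qg qD gT; case: rP => rh rE hT.
have [pq [pr qr]] : p != q /\ p != r /\ q != r.
  by move: Upqr; rewrite /= !inE negb_or andbT => /andP[/andP[-> ->] ->].
have [|||||||||||| S2 [c2 [col2 S2E F2]]] := @add_mid_in _ _ _ y v q y' g col1 B1A.
- by rewrite !inE; neqs; rewrite eqxx ?orbT.
- exact: setU11.
- by rewrite inE y'B orbT.
- by neqs.
- exact: Ny.
- by apply: F1v; rewrite !inE eqxx ?orbT.
- exact: F1.
- by rewrite S1v.
- by rewrite S1E.
- by [].
- by rewrite S1E.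
- by rewrite S1v.
have B2A : y |: (v |: A :\: X) \subset A by rewrite subUset sub1set yA.
have vB2 : v \in y |: (v |: A :\: X) by rewrite !inE eqxx orbT.
have [|||||||||||| S3 [c3 [col3 S3E F3]]] := @add_mid_in _ _ _ z v r z' h col2 B2A.
- by rewrite !inE; neqs; rewrite eqxx ?orbT.
- exact: vB2.
- by rewrite !inE z'A; neqs; rewrite ?orbT.
- by neqs.
- exact: Nz.
- apply: F2; [exact: setU11 | | by rewrite eq_sym | by_neqs].
  by apply: F1v; rewrite !inE eqxx ?orbT.
- by apply: F2; [by rewrite inE z'B orbT | exact: F1 | by_neqs | by_neqs].
- by rewrite S2E ?setU11 // S1v.
- by rewrite S2E ?S1E // inE z'B orbT.
- by [].
- by rewrite S2E ?S1E // inE z'B orbT.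
- by rewrite S2E ?setU11 // S1v.
have B3A : z |: (y |: (v |: A :\: X)) \subset A by rewrite subUset sub1set zA.
have [||||||||||||S4 [c4 [col4 _ _]]] := @add_path_in _ _ _ x1 x2 v p x' f col3 B3A.
- by rewrite !inE; neqs; rewrite eqxx ?orbT.
- by rewrite !inE; neqs; rewrite eqxx ?orbT.
- by rewrite !inE eqxx ?orbT.
- by rewrite !inE x'A; neqs; rewrite ?orbT.
- by neqs.
- exact: Nx1.
- by rewrite setUC in Nx2; rewrite Nx2 setUC.
- apply: F3; [exact: vB2 | | by [] | by_neqs].
  apply: F2; [exact: setU11 | | by [] | by_neqs].
  by apply: F1v; rewrite !inE eqxx ?orbT.
- apply: F3; [by rewrite !inE x'A; neqs; rewrite ?orbT | | by_neqs | by_neqs].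
  by apply: F2; [by rewrite inE x'B orbT | exact: F1 | by_neqs | by_neqs].
- by rewrite S3E ?S2E ?setU11 // S1v.
- by rewrite S3E ?S2E ?S1E // !inE x'A; neqs; rewrite ?orbT.
- by [].
apply: (cover_colorable _ col4).
apply/subsetP => u uA; rewrite !inE uA.
by case: (u == v); case: (u == x1); case: (u == x2); case: (u == y); case: (u == z).
Qed.

(** * Discharging *)

(* What a vertex [x] of degree 2 receives from each neighbor of degree 3. *)
Definition charge x :=
  if #|nbhd A x| == 2 then
    if [exists w in nbhd A x, #|nbhd A w| == 2] then 2 else 1
  else 0.

Lemma charge_leq2 x : charge x <= 2.
Proof. by rewrite /charge; case: eqP => // _; case: ifP. Qed.

Lemma charge_gt0 x : 0 < charge x -> #|nbhd A x| = 2.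
Proof. by rewrite /charge; case: eqP. Qed.

Lemma charge_gt1 x : 1 < charge x ->
  #|nbhd A x| = 2 /\ exists w, [/\ w \in A, e x w & #|nbhd A w| = 2].
Proof.
rewrite /charge; case: eqP => // -> ; case: existsP => // -[w /andP[]].
by rewrite inE => /andP[wA exw] /eqP dw _; split=> //; exists w.
Qed.

(** Charges are at most 2, so a sum above 3 contains two charges 2, excluded by
    [no_two_long_threads], or consists of 2, 1, 1, excluded by [no_long_thread_and_twos]. *)
Lemma charge_sum3 v : v \in A -> #|nbhd A v| = 3 ->
  \sum_(x in A | e v x) charge x <= 3.
Proof.
move=> vA d3.
have [a aN] : exists a, a \in nbhd A v by apply/card_gt0P; rewrite d3.
have dva : #|nbhd A v :\ a| == 2.
  by have := cardsD1 a (nbhd A v); rewrite aN d3; lia.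
have [b [c [bc Nbc]]] := cards2P _ dva.
have [ba ca] : b != a /\ c != a.
  by have := set21 b c; have := set22 b c; rewrite -Nbc !inE => /andP[-> _] /andP[-> _].
have [bN cN] : b \in nbhd A v /\ c \in nbhd A v.
  have := set21 b c; have := set22 b c; rewrite -Nbc => /setD1P[_ cN] /setD1P[_ bN].
  by split.
have -> : \sum_(x in A | e v x) charge x = charge a + (charge b + charge c).
  rewrite (eq_bigl (fun x => x \in nbhd A v)); last by move=> x; rewrite inE.
  rewrite (big_setD1 a) //= Nbc big_setU1 ?inE //= big_set1 //.
have dv w x : w \in nbhd A v -> e w x -> #|nbhd A x| = 2 -> v != x.
  by move=> _ _ dx; apply: contra_eq_neq d3 => ->; rewrite dx.
have two x y t : x \in nbhd A v -> y \in nbhd A v -> t \in nbhd A v ->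
    x != y -> t != x -> t != y -> 1 < charge x -> 1 < charge y -> False.
  move=> xN yN tN xy tx ty /charge_gt1[dx [x2 [x2A ex dx2]]] /charge_gt1[dy [y2 [y2A ey dy2]]].
  have vx := dv x x2 xN ex dx2; have vy := dv y y2 yN ey dy2.
  move: xN yN tN; rewrite !inE => /andP[xA evx] /andP[yA evy] /andP[tA evt].
  exact: (no_two_long_threads vA tA xA x2A yA y2A evt evx evy ex ey).
have three x y z : x \in nbhd A v -> y \in nbhd A v -> z \in nbhd A v ->
    x != y -> x != z -> y != z -> 1 < charge x -> 0 < charge y -> 0 < charge z -> False.
  move=> xN yN zN xy xz yz /charge_gt1[dx [x2 [x2A ex dx2]]] /charge_gt0 dy /charge_gt0 dz.
  have vx := dv x x2 xN ex dx2.
  move: xN yN zN; rewrite !inE => /andP[xA evx] /andP[yA evy] /andP[zA evz].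
  exact: (no_long_thread_and_twos vA xA x2A yA zA evx evy evz ex).
have [ab [ac cb]] : a != b /\ a != c /\ c != b by rewrite ![a == _]eq_sym ba ca eq_sym bc.
have := two a b c aN bN cN ab ca cb; have := two a c b aN cN bN ac ba bc.
have := two b c a bN cN aN bc ab ac.
have := three a b c aN bN cN ab ac bc; have := three b a c bN aN cN ba bc ac.
have := three c a b cN aN bN ca cb ab.
move: (charge_leq2 a) (charge_leq2 b) (charge_leq2 c).
case: (charge a) => [|[|[|?]]] //; case: (charge b) => [|[|[|?]]] //;
  case: (charge c) => [|[|[|?]]] //= _ _ _; try by [];
  do ?[by move=> /(_ isT isT isT) | by move=> /(_ isT isT) | move=> _].
Qed.

(** If one neighbor has degree 2, the other has degree 3 by [no_three_thread] and gives 2; otherwise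
    both neighbors have degree 3 and give 1 each. *)
Lemma charge_received x : x \in A -> #|nbhd A x| = 2 ->
  2 <= \sum_(v in A | e x v && (#|nbhd A v| == 3)) charge x.
Proof.
move=> xA d2; rewrite sum_nat_cond_const.
have deg v : v \in A -> #|nbhd A v| != 2 -> #|nbhd A v| = 3.
  by move=> vA; have := A_cubic vA; have := min_degree vA; lia.
have [a [b [ab Nx]]] : exists a b, a != b /\ nbhd A x = [set a; b].
  by apply/cards2P; rewrite d2.
have /setIdP[aA exa] : a \in nbhd A x by rewrite Nx set21.
have /setIdP[bA exb] : b \in nbhd A x by rewrite Nx set22.
rewrite /charge d2 eqxx; case: ifPn => [|].
  move=> /existsP[w /andP[]]; rewrite inE => /andP[wA exw] /eqP dw.
  apply: (@leq_trans (1 * 2)) => //; rewrite leq_mul2r /=; apply/card_gt0P.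
  have Nw u : u \in nbhd A x -> u != w -> #|nbhd A u| = 3.
    rewrite inE => /andP[uA exu] uw; apply: deg => //; apply/eqP => du.
    by apply: (@no_three_thread u x w) => //; rewrite e_sym.
  have [aw|aw] := eqVneq a w.
    exists b; rewrite inE bA exb Nw //; first by rewrite Nx set22.
    by rewrite -aw eq_sym.
  by exists a; rewrite inE aA exa Nw // Nx set21.
move=> /existsPn no2; rewrite muln1.
apply: (@leq_trans #|nbhd A x|); first by rewrite d2.
apply: subset_leq_card.
apply/subsetP => u uN; have := no2 u; rewrite uN /= => du.
by move: uN; rewrite !inE => /andP[uA ->]; rewrite uA deg.
Qed.

(** A vertex of degree [k] has weight [5 k - 12], which is -2 for degree 2 and 3 for degree 3. Each
    vertex of degree 2 receives its missing 2, and each vertex of degree 3 gives away at most its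
    3. *)
Lemma minimal_uncolorable_dense : 12 * #|A| <= 5 * \sum_(v in A) #|nbhd A v|.
Proof.
have key : \sum_(v in A) 2 * (#|nbhd A v| == 2) <= \sum_(v in A) 3 * (#|nbhd A v| == 3).
  apply: (@leq_trans (\sum_(x in A) \sum_(v in A | e x v && (#|nbhd A v| == 3)) charge x)).
    apply: leq_sum => x xA; case: eqP => [d2|_] //; exact: charge_received.
  rewrite (exchange_big_dep (fun v => v \in A)) /=; last by move=> x v _ /andP[].
  apply: leq_sum => v vA; case: eqP => [d3|_].
    apply: (@leq_trans 3) => //; rewrite (eq_bigl (fun x => (x \in A) && e v x)).
      exact: charge_sum3.
    by move=> x; rewrite vA andbT e_sym.
  by rewrite big_pred0 // => x; rewrite !andbF.
rewrite mulnC -sum_nat_const big_distrr /=.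
have : \sum_(v in A) 12 + \sum_(v in A) 3 * (#|nbhd A v| == 3) <=
    \sum_(v in A) 5 * #|nbhd A v| + \sum_(v in A) 2 * (#|nbhd A v| == 2).
  rewrite -!big_split /=; apply: leq_sum => v vA.
  have := A_cubic vA; have := min_degree vA.
  by case: #|nbhd A v| => [|[|[|[|?]]]].
by move: key; lia.
Qed.

End MinimalUncolorable.

Lemma sparse_colorable :
    (forall s, uniq s -> cycle e s -> 2 < size s -> 6 < size s) ->
    (forall A v, v \in A -> #|nbhd A v| <= 3) ->
    (forall A, A != set0 -> 5 * \sum_(v in A) #|nbhd A v| < 12 * #|A|) ->
  forall A, colorable A.
Proof.
move=> girth cubic sparse A; have [n] := ubnP #|A|; elim: n A => // n IH A An.
apply: boolp.contrapT => ncol.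
have A_min B : B \proper A -> colorable B.
  by move=> BA; apply: IH; apply: leq_trans (proper_card BA) _.
have := minimal_uncolorable_dense girth ncol A_min (cubic A).
rewrite leqNgt sparse //.
apply: contra_notN ncol => /eqP ->; exists (fun=> set0), (fun _ _ => ord0).
by split=> ?; rewrite ?inE // => ?; rewrite !inE.
Qed.
End PartialColorings.

(** * The cycle space of a grid minor *)

Import GRing.Theory.
Local Open Scope ring_scope.

(** * Sums and boundaries modulo 2 *)

Lemma F2_addxx (x : 'F_2) : x + x = 0.
Proof. exact/addrr_pchar2/pchar_Fp. Qed.

Lemma F2_addr_eq0 (x y : 'F_2) : x + y = 0 -> x = y.
Proof. by move=> xy; rewrite -[x]addr0 -(F2_addxx y) addrA xy add0r. Qed.

Lemma F2_eq1 (x : 'F_2) : x != 0 -> x = 1.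
Proof. by case: x => [[|[|]]] //= ? _; apply/val_inj. Qed.

Lemma F2_nat (n : nat) : n%:R = (odd n)%:R :> 'F_2.
Proof.
elim: n => // n IH; rewrite mulrSr IH /=.
by case: odd; rewrite ?F2_addxx ?add0r.
Qed.

(** The contributions of [(x, y)] and [(y, x)] cancel. *)
Lemma F2_sum_symmetric (T : finType) (P : pred T) (g : T -> T -> 'F_2) :
  (forall x y, g x y = g y x) -> (forall x, g x x = 0) ->
  \sum_(x | P x) \sum_(y | P y) g x y = 0.
Proof.
move=> gC g0; rewrite pair_big /=.
pose lt (p : T * T) := (enum_rank p.1 < enum_rank p.2)%N.
rewrite (bigID lt) /= [X in _ + X](bigID (fun p => p.1 == p.2)) /=.
rewrite [X in _ + (X + _)]big1 ?add0r; last by move=> [x y] /= /andP[_ /eqP->].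
rewrite [X in _ + X](reindex_inj (h := fun p => (p.2, p.1))) /=; last by move=> [x y] [x' y'] /= [-> ->].
rewrite [X in _ + X](eq_big (fun p => P p.1 && P p.2 && lt p) (fun p => g p.1 p.2)) ?F2_addxx //.
move=> [x y]; rewrite /lt /= [P y && _]andbC -andbA; congr (_ && _).
by rewrite -leqNgt [RHS]ltn_neqAle andbC eq_sym val_eqE (inj_eq enum_rank_inj).
Qed.

(** A point and the root of its component bound a path. Summing these pairs over the support of [b]
    gives [b] back: each root is hit once for every point of its component in the support, an even
    number of times. *)
Lemma F2_boundary (T : finType) (r : rel T) (b : T -> 'F_2) :
    symmetric r -> irreflexive r ->
    (forall x, \sum_(y | connect r x y) b y = 0) ->
  exists g : T -> T -> 'F_2, [/\ forall x y, g x y = g y x,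
    forall x y, ~~ r x y -> g x y = 0 & forall x, \sum_y g x y = b x].
Proof.
move=> rC rI b0.
pose isb (c : T -> 'F_2) := exists g : T -> T -> 'F_2, [/\ forall x y, g x y = g y x,
    forall x y, ~~ r x y -> g x y = 0 & forall x, \sum_y g x y = c x].
have isb_ext c c' : c =1 c' -> isb c -> isb c'.
  by move=> cc' [g [g1 g2 g3]]; exists g; split=> // x; rewrite g3.
have isb0 : isb (fun=> 0) by exists (fun _ _ => 0); split=> // x; rewrite big1.
have isbD c c' : isb c -> isb c' -> isb (fun x => c x + c' x).
  move=> [g [g1 g2 g3]] [h [h1 h2 h3]]; exists (fun x y => g x y + h x y); split.
  - by move=> x y; rewrite g1 h1.
  - by move=> x y nr; rewrite g2 ?h2 ?addr0.
  - by move=> x; rewrite big_split /= g3 h3.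
have isbZ a c : isb c -> isb (fun x => a * c x).
  move=> [g [g1 g2 g3]]; exists (fun x y => a * g x y); split.
  - by move=> x y; rewrite g1.
  - by move=> x y nr; rewrite g2 ?mulr0.
  - by move=> x; rewrite -mulr_sumr g3.
have isb_sum (I : seq T) (F : T -> T -> 'F_2) :
    (forall i, isb (F i)) -> isb (fun x => \sum_(i <- I) F i x).
  move=> FI; elim: I => [|i I IH]; first by apply: isb_ext isb0 => x; rewrite big_nil.
  by apply: isb_ext (isbD _ _ (FI i) IH) => x; rewrite big_cons.
pose delta (y x : T) : 'F_2 := (x == y)%:R.
have isb_edge y z : r y z -> isb (fun x => delta y x + delta z x).
  move=> ryz; have yz : y != z by apply: contraTneq ryz => ->; rewrite rI.
  exists (fun u w => delta y u * delta z w + delta z u * delta y w); split.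
  - by move=> u w; rewrite addrC mulrC [X in _ + X]mulrC.
  - move=> u w; rewrite /delta; case: (u =P y) => [->|_].
      case: (w =P z) => [->|_]; first by rewrite ryz.
      by rewrite mulr0 (negPf yz) mul0r addr0.
    rewrite mul0r add0r; case: (u =P z) => [->|_]; last by rewrite mul0r.
    by case: (w =P y) => [->|_]; rewrite ?mulr0 // rC ryz.
  - have sumd a : \sum_w delta a w = 1.
      by rewrite (bigD1 a) //= /delta eqxx big1 ?addr0 // => w /negPf->.
    by move=> u; rewrite big_split /= -!mulr_sumr !sumd !mulr1.
have isb_conn y z : connect r y z -> isb (fun x => delta y x + delta z x).
  case/connectP => p; elim: p y => [|a p IH] y /=.
    by move=> _ ->; apply: isb_ext isb0 => x; rewrite F2_addxx.
  case/andP=> rya pa zE; apply: isb_ext (isbD _ _ (isb_edge _ _ rya) (IH _ pa zE)) => x.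
  by rewrite -addrA (addrA (delta a x)) F2_addxx add0r.
have cC : connect_sym r by apply: sym_connect_sym.
have sumF : isb (fun x => \sum_(y <- enum T) b y * (delta y x + delta (fingraph.root r y) x)).
  by apply: isb_sum => y; apply: isbZ; apply: isb_conn; exact: connect_root.
apply: isb_ext sumF => x; rewrite big_enum /=.
under eq_bigr do rewrite mulrDr.
rewrite big_split /= (bigD1 x) //= /delta eqxx mulr1 big1 ?addr0; last first.
  by move=> y yx; rewrite eq_sym (negPf yx) mulr0.
rewrite -[RHS]addr0; congr (_ + _).
case: (boolP (fingraph.root r x == x)) => [/eqP rx|rx].
  rewrite -[RHS](b0 x) [RHS]big_mkcond; apply: eq_bigr => y _ /=.
  have -> : (x == fingraph.root r y) = connect r x y by rewrite -(root_connect cC) rx.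
  by case: ifP; rewrite ?mulr1 ?mulr0.
rewrite big1 // => y _; case: eqP => [xE|_]; last by rewrite mulr0.
by move: rx; rewrite xE (root_root cC) eqxx.
Qed.

(** A path is prolonged at its start by a neighbor other than its second vertex. Either this closes
    a cycle or the path grows, and it cannot outgrow [T]. *)
Lemma cycle_of_degrees (T : finType) (r : rel T) (x y : T) :
    symmetric r -> irreflexive r -> (forall v, #|[set w | r v w]| != 1) -> r x y ->
  exists s, [/\ uniq s, cycle r s & (2 < size s)%N].
Proof.
move=> rC rI deg rxy.
suff H n : (exists s, [/\ uniq s, cycle r s & (2 < size s)%N]) \/
    exists a p, [/\ uniq (a :: p), path r a p & size p = n.+1].
  case: (H #|T|) => // -[a [p [/card_uniqP Uap _ sp]]].
  by have := max_card (mem (a :: p)); rewrite Uap /= sp => /ltnW; rewrite ltnn.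
elim: n => [|n [|[a [[|b p] [Uabp pabp sp]]]]] //.
- right; exists x, [:: y]; split; rewrite //= ?rxy // inE andbT.
  by apply: contraTneq rxy => ->; rewrite rI.
- by left.
have [rab pbp] : r a b /\ path r b p by apply/andP.
have [c [rac cb]] : exists c, r a c /\ c != b.
  have bN : b \in [set w | r a w] by rewrite inE.
  have /subsetPn[c] : ~~ ([set w | r a w] \subset [set b]).
    apply/negP => /subset_leq_card; rewrite cards1 => d1.
    by have := deg a; rewrite eqn_leq d1 card_gt0 => /negP[]; apply/set0Pn; exists b.
  by rewrite !inE => rac cb; exists c.
have ca : c != a by apply: contraTneq rac => ->; rewrite rI.
case: (boolP (c \in p)) => cp; last first.
  right; exists c, [:: a, b & p]; split; last by rewrite /= -sp.
    by rewrite cons_uniq Uabp !inE (negPf ca) (negPf cb) (negPf cp).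
  by rewrite /= rC rac rab.
left; case/splitPr: cp Uabp pbp {pabp sp} => p1 p2 U pbp.
exists [:: a, b & rcons p1 c]; split; last by rewrite /= size_rcons.
  move: U; rewrite -cat_rcons -!cat_cons cat_uniq => /and3P[] //.
rewrite /= rab rcons_path last_rcons rC rac andbT.
by move: pbp; rewrite -cat_rcons cat_path => /andP[].
Qed.

(** * Unit squares span the cycle space of a grid *)

Section Grid.
Variable m : nat.
Notation point := ('I_m.+1 * 'I_m.+1)%type.
(** One more row and column than there are points: this adds squares beyond the border, so that
    border edges also have a square on either side. *)
Notation square := ('I_m.+2 * 'I_m.+2)%type.

Definition grid_adj : rel point := fun x y =>
  ((x.2 == y.2) && ((x.1.+1 == y.1 :> nat) || (y.1.+1 == x.1 :> nat)))
  || ((x.1 == y.1) && ((x.2.+1 == y.2 :> nat) || (y.2.+1 == x.2 :> nat))).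

(* The square [(i, j)] has [(i, j)] as its upper right corner; the two squares
   below are those on either side of the edge [xy]. *)
Definition square_low (x y : point) : square :=
  (inord (maxn x.1 y.1), inord (maxn x.2 y.2)).
Definition square_high (x y : point) : square :=
  (inord (minn x.1 y.1).+1, inord (minn x.2 y.2).+1).

Lemma grid_adj_sym : symmetric grid_adj.
Proof.
by move=> x y; rewrite /grid_adj (eq_sym x.2) (eq_sym x.1); congr (_ && _ || _ && _); rewrite orbC.
Qed.

Lemma grid_adj_irrefl : irreflexive grid_adj.
Proof. by move=> x; rewrite /grid_adj !eqxx /=; apply/negP; lia. Qed.

Lemma square_lowC x y : square_low x y = square_low y x.
Proof. by rewrite /square_low maxnC [maxn x.2 _]maxnC. Qed.

Lemma square_highC x y : square_high x y = square_high y x.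
Proof. by rewrite /square_high minnC [minn x.2 _]minnC. Qed.

(** Each of the four squares around an interior point borders exactly two of the four edges at
    it. *)
Lemma grid_coboundary (x : point) (f : square -> 'F_2) :
    (0 < x.1 < m)%N -> (0 < x.2 < m)%N ->
  \sum_(y | grid_adj x y) (f (square_low x y) + f (square_high x y)) = 0.
Proof.
case: x => [[i i_m] [j j_m]] /= /andP[i0 im] /andP[j0 jm].
pose s : seq point := [:: (inord i.+1, inord j); (inord i.-1, inord j);
                         (inord i, inord j.+1); (inord i, inord j.-1)].
have sE y : grid_adj (Ordinal i_m, Ordinal j_m) y = (y \in s).
  case: y => [[a am] [b bm]]; rewrite /grid_adj /s !inE !xpair_eqE -!val_eqE /=.
  by rewrite !inordK /=; lia.
rewrite (eq_bigl _ _ sE) -big_uniq; last first.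
  by rewrite /= !inE !xpair_eqE -!val_eqE /= !inordK /=; lia.
rewrite /s !big_cons big_nil /square_low /square_high /= !inordK; try lia.
rewrite !maxnn !minnn (maxn_idPr (leqnSn i)) (minn_idPl (leqnSn i)).
rewrite (maxn_idPr (leqnSn j)) (minn_idPl (leqnSn j)).
rewrite (maxn_idPl (leq_pred i)) (minn_idPr (leq_pred i)).
rewrite (maxn_idPl (leq_pred j)) (minn_idPr (leq_pred j)) !prednK //.
set a := f _; set b := f _; set c := f _; set d := f _.
have -> : a + b + (c + d + (d + b + (c + a + 0))) = (a + a) + (b + b) + ((c + c) + (d + d)).
  by ring.
by rewrite !F2_addxx.
Qed.

Section Cocycle.
Variable g : point -> point -> 'F_2.
Hypotheses (gC : forall x y, g x y = g y x)
  (g_supp : forall x y, ~~ grid_adj x y -> g x y = 0)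
  (g_even : forall x, \sum_y g x y = 0).

Let at_ (i j : nat) : point := (inord i, inord j).
Let hor i j := if (i < m)%N && (j < m.+1)%N then g (at_ i j) (at_ i.+1 j) else 0.
Let ver i j := if (i < m.+1)%N && (j < m)%N then g (at_ i j) (at_ i j.+1) else 0.
(* The number of horizontal edges of [g] below the square [(i, j)], modulo 2. *)
Let below i j : 'F_2 := if i is i'.+1 then \sum_(k < j) hor i' k else 0.

(** This is [g_even] in coordinates; edges that would leave the grid count as 0, which treats border
    points uniformly. *)
Lemma even_at i j : (i < m.+1)%N -> (j < m.+1)%N ->
  hor i j + (if i is i'.+1 then hor i' j else 0)
  + (ver i j + (if j is j'.+1 then ver i j' else 0)) = 0.
Proof.
move=> im jm; rewrite -[RHS](g_even (at_ i j)).
pose G y := g (at_ i j) y.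
pose P1 (y : point) := (i.+1 == y.1 :> nat) && (j == y.2 :> nat).
pose P2 (y : point) := (y.1.+1 == i :> nat) && (j == y.2 :> nat).
pose P3 (y : point) := (i == y.1 :> nat) && (j.+1 == y.2 :> nat).
pose P4 (y : point) := (i == y.1 :> nat) && (y.2.+1 == j :> nat).
transitivity (\sum_(y | P1 y) G y + \sum_(y | P2 y) G y
  + (\sum_(y | P3 y) G y + \sum_(y | P4 y) G y)); last first.
  rewrite (big_mkcond P1) (big_mkcond P2) (big_mkcond P3) (big_mkcond P4) -!big_split /=; apply: eq_bigr => y _.
  have : grid_adj (at_ i j) y = [|| P1 y, P2 y, P3 y | P4 y].
    by rewrite /grid_adj /P1 /P2 /P3 /P4 -!val_eqE /= !inordK //; lia.
  have [N12 N34] : ~~ (P1 y && P2 y) /\ ~~ (P3 y && P4 y).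
    by rewrite /P1 /P2 /P3 /P4; lia.
  have [N13 N14] : ~~ (P1 y && P3 y) /\ ~~ (P1 y && P4 y).
    by rewrite /P1 /P2 /P3 /P4; lia.
  have [N23 N24] : ~~ (P2 y && P3 y) /\ ~~ (P2 y && P4 y).
    by rewrite /P1 /P2 /P3 /P4; lia.
  case: (P1 y) (P2 y) (P3 y) (P4 y) N12 N13 N14 N23 N24 N34 => [] [] [] [] //= _ _ _ _ _ _ adj;
    rewrite ?addr0 ?add0r //.
  by rewrite /G g_supp ?adj.
have sum1 (P : pred point) a b : (a < m.+1)%N -> (b < m.+1)%N ->
    (forall y, P y = (y.1 == a :> nat) && (y.2 == b :> nat)) ->
    \sum_(y | P y) G y = G (at_ a b).
  move=> am bm PE; rewrite (big_pred1 (at_ a b)) // => y.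
  by case: y => a' b'; rewrite PE /at_ /= xpair_eqE -!val_eqE /= !inordK.
have sum0 (P : pred point) : P =1 pred0 -> \sum_(y | P y) G y = 0.
  by move=> P0; rewrite big_pred0.
congr (_ + _ + (_ + _)).
- rewrite /hor jm andbT; case: ifP => i1; symmetry.
    by apply: sum1 => // y; rewrite /P1; lia.
  by apply: sum0 => -[[a am] b]; rewrite /P1 /=; lia.
- case iE: i => [|i']; symmetry; first by apply: sum0 => y; rewrite /P2 iE.
  rewrite /hor jm andbT ifT; last by lia.
  transitivity (G (at_ i' j)); last by rewrite /G iE.
  by apply: sum1 => [||y] //; rewrite /P2; lia.
- rewrite /ver im /=; case: ifP => j1; symmetry.
    by apply: sum1 => // y; rewrite /P3; lia.
  by apply: sum0 => -[a [b bm]]; rewrite /P3 /=; lia.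
- case jE: j => [|j']; symmetry; first by apply: sum0 => y; rewrite /P4 jE andbF.
  rewrite /ver im ifT; last by lia.
  transitivity (G (at_ i j')); last by rewrite /G jE.
  by apply: sum1 => [||y] //; rewrite /P4; lia.
Qed.

Lemma hor_below i j : hor i j = below i.+1 j + below i.+1 j.+1.
Proof. by rewrite /below big_ord_recr addrA F2_addxx add0r. Qed.

(** Adding up the evenness at the points [(i, 0)] to [(i, j)], the vertical edges telescope to the
    last one and the horizontal ones form the two values of [below]. *)
Lemma ver_below i j : (i < m.+1)%N -> (j < m.+1)%N ->
  ver i j = below i j.+1 + below i.+1 j.+1.
Proof.
move=> im; elim: j => [|j IH] jm; have := even_at im jm.
  rewrite addr0; have -> : (if i is i'.+1 then hor i' 0%N else 0) = below i 1.
    by case: (i) => [|i'] //=; rewrite big_ord1.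
  have -> : hor i 0%N = below i.+1 1 by rewrite /= big_ord1.
  by move/F2_addr_eq0 => <-; rewrite addrC.
have -> : (if i is i'.+1 then hor i' j.+1 else 0) = below i j.+1 + below i j.+2.
  by case: (i) => [|i']; [rewrite /= addr0 | exact: hor_below].
rewrite hor_below IH; last by lia.
move=> E; apply: F2_addr_eq0; rewrite -[RHS]E.
set a := below _ _; set b := below _ _; set c := below _ _; set d := below _ _; set v := ver _ _.
have -> : c + b + (d + a) + (v + (d + c)) = v + (a + b) + ((c + c) + (d + d)) by ring.
by rewrite !F2_addxx addr0.
Qed.

(** An even edge set divides the squares into two sides, told apart by the parity of its crossings
    with a downward ray. *)
Lemma grid_cocycle : exists f : square -> 'F_2,
  forall x y, grid_adj x y -> g x y = f (square_low x y) + f (square_high x y).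
Proof.
exists (fun s : square => below s.1 s.2).
have right (x y : point) : x.2 = y.2 -> x.1.+1 = y.1 :> nat ->
    g x y = below (square_low x y).1 (square_low x y).2
            + below (square_high x y).1 (square_high x y).2.
  case: x y => [[i im] [j jm]] [[i' im'] j'] /= <- {j'} ii'.
  subst i'; rewrite /square_low /square_high /= maxnn minnn maxnE minnE.
  have -> : (i + (i.+1 - i) = i.+1)%N by lia.
  have -> : (i - (i - i.+1) = i)%N by lia.
  rewrite !inordK; try lia.
  rewrite -hor_below /hor ifT; last by lia.
  by congr (g _ _); rewrite /at_ /=; congr (_, _); apply/val_inj; rewrite /= inordK.
have up (x y : point) : x.1 = y.1 -> x.2.+1 = y.2 :> nat ->
    g x y = below (square_low x y).1 (square_low x y).2
            + below (square_high x y).1 (square_high x y).2.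
  case: x y => [[i im] [j jm]] [i' [j' jm']] /= <- {i'} jj'.
  subst j'; rewrite /square_low /square_high /= maxnn minnn maxnE minnE.
  have -> : (j + (j.+1 - j) = j.+1)%N by lia.
  have -> : (j - (j - j.+1) = j)%N by lia.
  rewrite !inordK; try lia.
  rewrite -ver_below; try lia.
  rewrite /ver ifT; last by lia.
  by congr (g _ _); rewrite /at_ /=; congr (_, _); apply/val_inj; rewrite /= inordK.
move=> x y /orP[] /andP[/eqP xy] /orP[] /eqP xy'.
- exact: right.
- by rewrite gC square_lowC square_highC; apply: right.
- exact: up.
- by rewrite gC square_lowC square_highC; apply: up.
Qed.
End Cocycle.
End Grid.

(** * Chains of a graph that is a minor of a grid *)

Section GridMinor.
Variables (V : finType) (e : rel V) (m : nat).
Notation point := ('I_m.+1 * 'I_m.+1)%type.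
Notation square := ('I_m.+2 * 'I_m.+2)%type.
Variable phi : point -> option V.
Hypotheses (e_sym : symmetric e) (e_irr : irreflexive e).
Hypothesis phi_interior : forall x u, phi x = Some u ->
  (0 < x.1 < m)%N /\ (0 < x.2 < m)%N.
Hypothesis phi_connected : forall x y u, phi x = Some u -> phi y = Some u ->
  connect (fun a b => grid_adj a b && (phi a == phi b)) x y.
Hypothesis phi_adj : forall u v, e u v ->
  exists x y, [/\ grid_adj x y, phi x = Some u & phi y = Some v].
Variable A : {set V}.

(** Ranking the ends selects one orientation, so that every edge of the graph on [A] occurs once. *)
Definition is_oriented_edge (p : V * V) :=
  [&& p.1 \in A, p.2 \in A, e p.1 p.2 & (enum_rank p.1 < enum_rank p.2)%N].
Definition oedge := {p : V * V | is_oriented_edge p}.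
Implicit Types (i : oedge) (u v w : V) (x y : point) (s t : square).

Definition incident i u := ((val i).1 == u) || ((val i).2 == u).
Definition joins i u v := (val i == (u, v)) || (val i == (v, u)).

Lemma oedge_neq i : (val i).1 != (val i).2.
Proof.
by case/and4P: (valP i) => _ _ _; apply: contraTneq => ->; rewrite ltnn.
Qed.

Lemma joinsC i u v : joins i u v = joins i v u.
Proof. by rewrite /joins orbC. Qed.

Lemma joins_inj i j u v : joins i u v -> joins j u v -> i = j.
Proof.
move=> iuv juv; apply/val_inj.
have := valP i; have := valP j; rewrite /is_oriented_edge.
case/orP: iuv => /eqP->; case/orP: juv => /eqP-> //= /and4P[_ _ _ r1] /and4P[_ _ _ r2].
  by have := ltn_trans r1 r2; rewrite ltnn.
by have := ltn_trans r1 r2; rewrite ltnn.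
Qed.

Lemma joins_adj i u v : joins i u v -> [/\ u \in A, v \in A & e u v].
Proof.
have := valP i; rewrite /is_oriented_edge => H /orP[]/eqP E; move: H; rewrite E /=.
  by case/and4P.
by rewrite e_sym; case/and4P.
Qed.

Lemma exists_joins u v : u \in A -> v \in A -> e u v -> exists i, joins i u v.
Proof.
move=> uA vA euv; have uv : u != v by apply: contraTneq euv => ->; rewrite e_irr.
have [uv_lt|vu_lt|/val_inj/enum_rank_inj uvE] := ltngtP (enum_rank u) (enum_rank v).
- have H : is_oriented_edge (u, v) by rewrite /is_oriented_edge /= uA vA euv.
  by exists (exist (fun p => is_oriented_edge p) _ H); rewrite /joins eqxx.
- have H : is_oriented_edge (v, u) by rewrite /is_oriented_edge /= uA vA e_sym euv.
  by exists (exist (fun p => is_oriented_edge p) _ H); rewrite /joins eqxx orbT.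
- by rewrite uvE eqxx in uv.
Qed.

Definition edge_rel (P : pred oedge) u v := [exists i, P i && joins i u v].

Lemma edge_relC P : symmetric (edge_rel P).
Proof. by move=> u v; apply: eq_existsb => i; rewrite joinsC. Qed.

Lemma card_edge_rel P u :
  #|[set v | edge_rel P u v]| = #|[set i | P i & incident i u]|.
Proof.
pose other i := if (val i).1 == u then (val i).2 else (val i).1.
have joins_other i : incident i u -> joins i u (other i).
  rewrite /joins /other /incident; case: (val i) => a b /=; rewrite !xpair_eqE /=.
  by case: eqP => [->|_] /=; rewrite ?eqxx //= => /eqP->; rewrite !eqxx orbT.
have joins_inc i v : joins i u v -> incident i u /\ v = other i.
  rewrite /joins /other /incident; case: (val i) (oedge_neq i) => a b /= ab.
  case/orP => /eqP[-> ->]; rewrite eqxx ?orbT //; split=> //.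
  by case: eqP.
rewrite -(card_in_imset (f := other) (D := [set i | P i & incident i u])).
  congr #|pred_of_set _|; apply/setP => v; rewrite inE; apply/existsP/imsetP.
    by move=> [i /andP[Pi /joins_inc[iu vE]]]; exists i => //; rewrite inE Pi.
  move=> [i]; rewrite inE => /andP[Pi /joins_other iu] ->; exists i.
  by rewrite Pi.
move=> i j; rewrite !inE => /andP[_ /joins_other iu] /andP[_ /joins_other ju] ij.
by apply: joins_inj iu _; rewrite ij.
Qed.

Lemma sum_incident (P : pred oedge) :
  (\sum_u #|[set i | P i & incident i u]| = 2 * #|P|)%N.
Proof.
transitivity (\sum_u \sum_(i | P i) (incident i u : nat))%N.
  apply: eq_bigr => u _; rewrite -sum1dep_card big_mkcondr; apply: eq_bigr => i _.
  by case: incident.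
rewrite exchange_big /= -sum1_card big_distrr /=.
apply: eq_bigr => i Pi; rewrite muln1.
transitivity #|[set (val i).1; (val i).2]|; last by rewrite cards2 oedge_neq.
rewrite -sum1_card [RHS]big_mkcond /=; apply: eq_bigr => u _.
by rewrite !inE /incident ![u == _]eq_sym; case: ifP.
Qed.

Definition inc i u : 'F_2 := ((val i).1 == u)%:R + ((val i).2 == u)%:R.

Lemma incE i u : inc i u = (incident i u)%:R.
Proof.
rewrite /inc /incident; case: eqP => [<-|_]; last by rewrite add0r.
by rewrite eq_sym (negPf (oedge_neq i)) addr0.
Qed.

Definition bdry (z : {ffun oedge -> 'F_2}) u := \sum_i inc i u * z i.

Lemma bdry_even z u : (bdry z u = 0) -> ~~ odd #|[set i | z i != 0 & incident i u]|.
Proof.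
have -> : bdry z u = #|[set i | z i != 0 & incident i u]|%:R.
  rewrite -sum1_card natr_sum big_mkcond; apply: eq_bigr => i _.
  rewrite incE inE andbC; case: incident => /=; last by rewrite mul0r.
  by rewrite mul1r; case: eqP => [->|/eqP/F2_eq1].
by rewrite F2_nat; case: odd.
Qed.

Lemma bdry_off z u : u \notin A -> bdry z u = 0.
Proof.
move=> uA; apply: big1 => i _; rewrite incE.
case: (boolP (incident i u)) => [|_]; last by rewrite mul0r.
have /and4P[iA jA _ _] := valP i.
by case/orP => /eqP uE; move: uA; rewrite -uE ?iA ?jA.
Qed.

Lemma sum_bdry z : \sum_u bdry z u = 0.
Proof.
rewrite exchange_big /= big1 // => i _; rewrite -mulr_suml.
have one a : \sum_u (a == u)%:R = 1 :> 'F_2.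
  by rewrite (bigD1 a) //= eqxx big1 ?addr0 // => u /negPf; rewrite eq_sym => ->.
by rewrite /inc big_split /= !one F2_addxx mul0r.
Qed.

(** The support has even degrees and hence contains a cycle. Each vertex of the cycle has degree at
    least 2 in the support, and the degrees add up to twice the number of edges. *)
Lemma cycle_support (z : {ffun oedge -> 'F_2}) n :
    (forall s : seq V, uniq s -> cycle e s -> (2 < size s)%N -> (n <= size s)%N) ->
    z != 0 -> (forall u, bdry z u = 0) -> (n <= #|[set i | z i != 0%R]|)%N.
Proof.
move=> girth z0 bz.
have [i zi] : exists i, z i != 0.
  apply/existsP; apply: contraNT z0 => /existsPn z0; apply/eqP/ffunP => i.
  by rewrite ffunE; apply/eqP; have := z0 i; rewrite negbK.
pose r := edge_rel (fun i => z i != 0).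
have re : subrel r e by move=> u v /existsP[j /andP[_ /joins_adj[]]].
have rI : irreflexive r by move=> u; apply/negbTE/negP => ruu; have := re _ _ ruu; rewrite e_irr.
have deg u : ~~ odd #|[set v | r u v]| by rewrite card_edge_rel bdry_even.
have ri : r (val i).1 (val i).2.
  by apply/existsP; exists i; rewrite zi /joins -surjective_pairing eqxx.
have [|s [Us cs ss]] := cycle_of_degrees (@edge_relC _) rI _ ri.
  by move=> u; apply: contraNneq (deg u) => ->.
have ns : (n <= size s)%N by apply: girth => //; apply: sub_cycle cs.
rewrite (leq_trans ns) // -(leq_pmul2l (isT : 0 < 2)%N).
have -> : (2 * #|[set i | z i != 0%R]| = \sum_u #|[set v | r u v]|)%N.
  rewrite cardsE -sum_incident; apply: eq_bigr => u _.
  by rewrite card_edge_rel.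
rewrite -(card_uniqP Us) -sum1_card big_distrr /=.
rewrite [leqRHS](bigID (fun u => u \in s)) /= -[leqLHS]addn0 leq_add //.
apply: leq_sum => u us; have := deg u.
suff : (0 < #|[set v | r u v]|)%N by case: #|_| => [|[|]].
apply/card_gt0P; exists (next s u); rewrite inE; exact: next_cycle.
Qed.

Lemma edge_count : (2 * #|{: oedge}| = \sum_(u in A) #|[set v in A | e u v]|)%N.
Proof.
rewrite -(sum_incident predT) [RHS]big_mkcond /=; apply: eq_bigr => u _.
rewrite -(card_edge_rel predT); case: ifP => uA.
  apply: eq_card => v; rewrite !inE; apply/existsP/andP.
    by move=> [i /joins_adj[]].
  by move=> [vA euv]; have [i iuv] := exists_joins uA vA euv; exists i.
apply: eq_card0 => v; rewrite inE; apply/existsP => -[i /joins_adj[]].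
by rewrite uA.
Qed.

Definition in_model x := if phi x is Some u then u \in A else false.
Definition block x y := [&& grid_adj x y, phi x == phi y & in_model x].

(** One grid edge is fixed to represent each edge; by [phi_adj] the default is never reached. *)
Definition lift i : point * point :=
  odflt ((ord0, ord0), (ord0, ord0))
    [pick p | [&& grid_adj p.1 p.2, phi p.1 == Some (val i).1 & phi p.2 == Some (val i).2]].

Lemma liftP i : [/\ grid_adj (lift i).1 (lift i).2,
  phi (lift i).1 = Some (val i).1 & phi (lift i).2 = Some (val i).2].
Proof.
rewrite /lift; case: pickP => [p /and3P[-> /eqP-> /eqP->]//|np].
have /and4P[_ _ /phi_adj[x [y [xy px py]]] _] := valP i.
by have := np (x, y); rewrite /= xy px py !eqxx.
Qed.

Definition lifts i x y := (lift i == (x, y)) || (lift i == (y, x)).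

Lemma liftsC i x y : lifts i x y = lifts i y x.
Proof. by rewrite /lifts orbC. Qed.

Lemma lifts_lift i : lifts i (lift i).1 (lift i).2.
Proof. by rewrite /lifts -surjective_pairing eqxx. Qed.

Lemma liftsP i x y : lifts i x y -> [/\ grid_adj x y, phi x != phi y &
  exists u v, [/\ phi x = Some u, phi y = Some v & joins i u v]].
Proof.
have [adj p1 p2] := liftP i; have neq := oedge_neq i.
have pneq : phi (lift i).1 != phi (lift i).2.
  by rewrite p1 p2; apply: contraNneq neq => -[->].
case/orP => /eqP lE; move: adj p1 p2 pneq; rewrite lE /= => adj p1 p2 pneq; split=> //.
- by exists (val i).1, (val i).2; rewrite /joins -surjective_pairing eqxx.
- by rewrite grid_adj_sym.
- by rewrite eq_sym.
- by exists (val i).2, (val i).1; rewrite /joins -surjective_pairing eqxx orbT.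
Qed.

Lemma lifts_inj i j x y : lifts i x y -> lifts j x y -> i = j.
Proof.
case/liftsP => _ _ [u [v [px py iuv]]] /liftsP[_ _ [u' [v' [px' py' juv]]]].
move: px' py' juv; rewrite px py => -[<-] [<-]; exact: joins_inj.
Qed.

Definition chain (z : {ffun oedge -> 'F_2}) x y : 'F_2 := \sum_i (lifts i x y)%:R * z i.

Lemma chainC z x y : chain z x y = chain z y x.
Proof. by apply: eq_bigr => i _; rewrite liftsC. Qed.

Lemma chain_lifts z i x y : lifts i x y -> chain z x y = z i.
Proof.
move=> ixy; rewrite /chain (bigD1 i) //= ixy mul1r big1 ?addr0 // => j ji.
case: (boolP (lifts j x y)) => [jxy|_]; last by rewrite mul0r.
by rewrite (lifts_inj jxy ixy) eqxx in ji.
Qed.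

Lemma chain_off z x y : (forall i, ~~ lifts i x y) -> chain z x y = 0.
Proof. by move=> nl; apply: big1 => i _; rewrite (negPf (nl i)) mul0r. Qed.

Lemma chain_supp z x y : ~~ grid_adj x y || (phi x == phi y) -> chain z x y = 0.
Proof.
move=> H; apply: chain_off => i; apply: contraTN H => /liftsP[-> /negPf-> _] //.
Qed.

(** A lifted edge has an end in the branch set of [u] exactly when the edge is incident to [u]:
    contracting the branch sets turns the chain back into [z]. *)
Lemma sum_chain z u : \sum_(x | phi x == Some u) \sum_y chain z x y = bdry z u.
Proof.
rewrite (eq_bigr (fun x => \sum_i \sum_y (lifts i x y)%:R * z i)); last first.
  by move=> x _; rewrite exchange_big.
rewrite exchange_big /=; apply: eq_bigr => i _.
have [adj p1 p2] := liftP i.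
have one x : \sum_y (lifts i x y)%:R * z i
    = ((lift i).1 == x)%:R * z i + ((lift i).2 == x)%:R * z i.
  have ab : (lift i).1 != (lift i).2 by apply: contraTneq adj => ->; rewrite grid_adj_irrefl.
  rewrite -mulr_suml -mulrDl; congr (_ * _).
  rewrite /lifts; case: (lift i) ab => a b /= ab.
  rewrite (eq_bigr (fun y => ((a == x) && (b == y))%:R + ((b == x) && (a == y))%:R)); last first.
    move=> y _; rewrite !xpair_eqE [X in _ || X]andbC; case: (a =P x) => [ax|_]; last by rewrite add0r.
    case: (b =P x) => [bx|_]; last by rewrite orbF addr0.
    by rewrite ax bx eqxx in ab.
  have sum1 c : \sum_y (c == y)%:R = 1 :> 'F_2.
    by rewrite (bigD1 c) //= eqxx big1 ?addr0 // => y /negPf; rewrite eq_sym => ->.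
  rewrite big_split /=; congr (_ + _); case: eqP => _ /=; rewrite ?sum1 //; exact: big1.
rewrite (eq_bigr _ (fun x _ => one x)) big_split /=.
have sum2 c w : phi c = Some w -> \sum_(x | phi x == Some u) (c == x)%:R * z i = (w == u)%:R * z i.
  move=> pc; rewrite -mulr_suml; congr (_ * _).
  case: eqP => [wu|wu].
    rewrite (bigD1 c) /= ?pc ?wu // eqxx big1 ?addr0 // => x /andP[_ /negPf].
    by rewrite eq_sym => ->.
  apply: big1 => x /eqP px; case: eqP => // cx; case: wu.
  by move: px; rewrite -cx pc => -[].
by rewrite (sum2 _ _ p1) (sum2 _ _ p2) /inc mulrDl.
Qed.

(** * Faces of the minor and their boundaries *)

Definition used x y := block x y || [exists i, lifts i x y].

Definition dual_adj : rel square := fun s t =>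
  [exists x, exists y, [&& grid_adj x y, ~~ used x y &
    ((s, t) == (square_low x y, square_high x y)) ||
    ((t, s) == (square_low x y, square_high x y))]].

Lemma dual_adj_sym : symmetric dual_adj.
Proof. by move=> s t; apply: eq_existsb => x; apply: eq_existsb => y; rewrite orbC. Qed.

Definition face s := fingraph.root dual_adj s.

Lemma face_unused x y : grid_adj x y -> ~~ used x y ->
  face (square_low x y) = face (square_high x y).
Proof.
move=> adj nu; apply/eqP; rewrite (root_connect (sym_connect_sym dual_adj_sym)).
by apply: connect1; apply/existsP; exists x; apply/existsP; exists y; rewrite adj nu eqxx.
Qed.

(** An edge with the same face on both sides gets 1 + 1 = 0. The vector is 0 unless [s] represents
    its face, so that no face is counted twice. *)
Definition face_vector s : {ffun oedge -> 'F_2} :=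
  [ffun i => (face (square_low (lift i).1 (lift i).2) == s)%:R
           + (face (square_high (lift i).1 (lift i).2) == s)%:R].

Lemma face_vector_lifts s i x y : lifts i x y ->
  face_vector s i = (face (square_low x y) == s)%:R + (face (square_high x y) == s)%:R.
Proof.
by rewrite ffunE => /orP[]/eqP-> //=; rewrite square_lowC square_highC.
Qed.

Lemma bdry_face s u : bdry (face_vector s) u = 0.
Proof.
have [uA|] := boolP (u \in A); last exact: bdry_off.
pose c x y : 'F_2 := if grid_adj x y then
  (face (square_low x y) == s)%:R + (face (square_high x y) == s)%:R else 0.
have cC x y : c x y = c y x by rewrite /c grid_adj_sym square_lowC square_highC.
have cI x : c x x = 0 by rewrite /c grid_adj_irrefl.
have c_even x : phi x == Some u -> \sum_y c x y = 0.
  move=> /eqP/phi_interior[x1 x2]; rewrite -big_mkcond.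
  exact: (grid_coboundary (fun t => (face t == s)%:R) x1 x2).
have c_chain x y : phi x = Some u -> phi y != Some u -> c x y = chain (face_vector s) x y.
  move=> px py; case: (boolP [exists i, lifts i x y]) => [/existsP[i ixy]|/existsPn nl].
    rewrite (chain_lifts _ ixy) (face_vector_lifts _ ixy) /c.
    by case/liftsP: ixy => -> _ _.
  rewrite (chain_off _ nl) /c; case: ifP => // adj.
  rewrite (face_unused adj) ?F2_addxx //; apply/norP; split; last by apply/existsPn.
  by rewrite /block adj px eq_sym (negPf py).
rewrite -sum_chain.
rewrite (eq_bigr (fun x => \sum_(y | phi y == Some u) chain (face_vector s) x y
   + \sum_(y | phi y != Some u) chain (face_vector s) x y)); last first.
  by move=> x _; rewrite (bigID (fun y => phi y == Some u)).
rewrite big_split /= F2_sum_symmetric ?add0r; [|exact: chainC|]; last first.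
  by move=> x; rewrite chain_supp // grid_adj_irrefl.
rewrite (eq_bigr (fun x => \sum_(y | phi y != Some u) c x y)); last first.
  by move=> x /eqP px; apply: eq_bigr => y py; rewrite c_chain.
have : \sum_(x | phi x == Some u) \sum_y c x y = 0 by apply: big1.
rewrite (eq_bigr (fun x => \sum_(y | phi y == Some u) c x y
   + \sum_(y | phi y != Some u) c x y)); last first.
  by move=> x _; rewrite (bigID (fun y => phi y == Some u)).
by rewrite big_split /= F2_sum_symmetric ?add0r.
Qed.

Lemma block_sym : symmetric block.
Proof.
move=> x y; rewrite /block grid_adj_sym (eq_sym (phi x)) /in_model.
by case: eqP => [->|] //; rewrite !andbF.
Qed.

Lemma block_irrefl : irreflexive block.
Proof. by move=> x; rewrite /block grid_adj_irrefl. Qed.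

Lemma connect_block x y : in_model x -> connect block x y = (phi x == phi y).
Proof.
move=> mx; apply/idP/idP.
  case/connectP => p; elim: p x mx => [|a p IH] x mx /=; first by move=> _ ->.
  case/andP=> /and3P[_ /eqP xa _] pa yE; rewrite xa; apply: IH => //.
  by move: mx; rewrite /in_model xa.
move: mx; rewrite /in_model; case px: (phi x) => [u|] // uA /eqP/esym py.
case/connectP: (phi_connected px py) => p.
elim: p x px => [|a p IH] x px /=; first by move=> _ ->; exact: connect0.
case/andP=> /andP[xa /eqP pxa] pa yE.
apply: (@connect_trans _ _ a); last by apply: IH => //; rewrite -pxa.
by apply: connect1; rewrite /block xa pxa eqxx /in_model px.
Qed.

Lemma connect_block_out x y : ~~ in_model x -> connect block x y = (x == y).
Proof.
move=> mx; apply/idP/eqP => [|->]; last exact: connect0.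
by case/connectP => -[|a p] //= /andP[/and3P[_ _ mx']]; rewrite mx' in mx.
Qed.

Lemma cycle_faces z : (forall u, bdry z u = 0) ->
  exists F : square -> 'F_2, (forall s, F s = F (face s)) /\
    forall i, z i = F (square_low (lift i).1 (lift i).2) + F (square_high (lift i).1 (lift i).2).
Proof.
move=> bz.
have [x|g [gC g_supp g_bd]] := F2_boundary (b := fun x => \sum_y chain z x y) block_sym block_irrefl.
  case: (boolP (in_model x)) => mx.
    rewrite (eq_bigl _ _ (fun y => connect_block y mx)).
    move: mx; rewrite /in_model; case px: (phi x) => [u|] // uA.
    by rewrite -[RHS](bz u) -[RHS]sum_chain; apply: eq_bigl => y; rewrite eq_sym.
  rewrite (eq_bigl _ _ (fun y => connect_block_out y mx)).
  rewrite (big_pred1 x) => [|y]; last by rewrite /= eq_sym.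
  apply: big1 => y _; apply: chain_off => i; apply: contra mx => /liftsP[_ _ [u [v [px _ iuv]]]].
  by rewrite /in_model px; case: (joins_adj iuv).
pose h x y := chain z x y + g x y.
have [|||F FP] := @grid_cocycle m h.
- by move=> x y; rewrite /h chainC gC.
- move=> x y nadj; rewrite /h chain_supp ?nadj // add0r g_supp //.
  by apply: contra nadj => /and3P[].
- by move=> x; rewrite /h big_split /= g_bd F2_addxx.
exists F; split.
  have Fd s t : dual_adj s t -> F s = F t.
    move=> /existsP[x /existsP[y /and3P[adj /norP[nb /existsPn nl]]]] H.
    have := FP x y adj; rewrite /h chain_off // g_supp // addr0 => /esym/F2_addr_eq0 FE.
    by case/orP: H => /eqP[-> ->].
  move=> s; have := connect_root dual_adj s => /connectP[p].
  rewrite -/(face s); elim: p s (face s) => [|a p IH] s t /=; first by move=> _ ->.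
  by case/andP => /Fd -> pa tE; apply: IH.
move=> i; have [adj p1 p2] := liftP i; have neq := oedge_neq i.
rewrite -FP // /h (chain_lifts _ (lifts_lift i)) g_supp ?addr0 //.
apply/negP => /and3P[_ /eqP]; rewrite p1 p2 => -[pE]; by rewrite pE eqxx in neq.
Qed.

(** * Counting faces through the dimension of the cycle space *)

Section Counting.
Variable a0 : V.
Hypothesis a0A : a0 \in A.

(** Dropping the coordinate of [a0] leaves a target of dimension [#|A| - 1]; this is the origin of
    the +1 in the dimension of the kernel. *)
Definition bdry_off_root (z : {ffun oedge -> ('F_2)^o}) : {ffun {u | u \in A :\ a0} -> ('F_2)^o} :=
  [ffun u => bdry z (val u)].

Fact bdry_off_root_linear : linear bdry_off_root.
Proof.
move=> k z z'; apply/ffunP => u; rewrite !ffunE /bdry.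
rewrite scaler_sumr -big_split /=; apply: eq_bigr => i _.
by rewrite !ffunE mulrDr; congr (_ + _); apply: mulrCA.
Qed.

HB.instance Definition _ := GRing.isLinear.Build 'F_2 {ffun oedge -> ('F_2)^o}
  {ffun {u | u \in A :\ a0} -> ('F_2)^o} *:%R bdry_off_root bdry_off_root_linear.

(* The boundary sums to 0 over all vertices, so vanishing off [a0] suffices. *)
Lemma bdry_off_rootP z : bdry_off_root z = 0 <-> forall u, bdry z u = 0.
Proof.
split=> [z0 u|z0]; last by apply/ffunP => u; rewrite !ffunE z0.
have off u' : u' != a0 -> bdry z u' = 0.
  move=> ua; have [uA|] := boolP (u' \in A); last exact: bdry_off.
  have uA0 : u' \in A :\ a0 by rewrite !inE ua.
  by have /ffunP/(_ (exist (fun u => u \in A :\ a0) u' uA0)) := z0; rewrite !ffunE.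
have [->|/off//] := eqVneq u a0.
have := sum_bdry z; rewrite (bigD1 a0) //= big1 ?addr0 // => u' /off //.
Qed.

Lemma dim_cycles : (#|{: oedge}| < \dim (lker (linfun bdry_off_root)) + #|A|)%N.
Proof.
have := limg_ker_dim (linfun bdry_off_root) fullv; rewrite capfv dimvf.
have -> : dim {ffun oedge -> ('F_2)^o} = #|{: oedge}| by rewrite /dim /= muln1.
move=> <-; rewrite -addnS leq_add2l.
apply: leq_ltn_trans (dimvS (subvf _)) _; rewrite dimvf.
have -> : dim {ffun {u | u \in A :\ a0} -> ('F_2)^o} = #|{: {u | u \in A :\ a0}}|.
  by rewrite /dim /= muln1.
by rewrite card_sig (cardsD1 a0 A) a0A.
Qed.

Definition face_vectors : seq {ffun oedge -> ('F_2)^o} :=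
  [seq face_vector s | s <- enum {: square} & face_vector s != 0].

Lemma cycles_span : (lker (linfun bdry_off_root) <= <<face_vectors>>)%VS.
Proof.
apply/subvP => z; rewrite memv_ker lfunE /= => /eqP/bdry_off_rootP/cycle_faces[F [F_face zF]].
(* One term per face: at a square [t] the sum picks the representative of its face, where [F] has
   the same value as at [t]. *)
have -> : z = \sum_(s | face s == s) F s *: (face_vector s : {ffun oedge -> ('F_2)^o}).
  apply/ffunP => i; rewrite zF sum_ffunE.
  under eq_bigr => s _ do
    rewrite !ffunE -[_ *: _]/(F s * (_ + _)) mulrDr.
  have sumF t : \sum_(s | face s == s) F s * (face t == s)%:R = F t.
    rewrite (bigD1 (face t)) /=; last by rewrite /face root_root //; apply: sym_connect_sym; exact: dual_adj_sym.
    rewrite eqxx mulr1 big1 ?addr0 -?F_face // => s /andP[_ /negPf].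
    by rewrite eq_sym => ->; rewrite mulr0.
  by rewrite big_split /= !sumF.
apply: memv_suml => s _; apply: memvZ.
have [->|s0] := eqVneq (face_vector s) 0; first exact: mem0v.
by apply/memv_span/map_f; rewrite mem_filter s0 mem_enum.
Qed.

Lemma face_count n :
    (forall s : seq V, uniq s -> cycle e s -> (2 < size s)%N -> (n <= size s)%N) ->
  (n * size face_vectors <= 2 * #|{: oedge}|)%N.
Proof.
move=> girth; rewrite size_map size_filter -sum1_count big_distrr /=.
apply: (@leq_trans (\sum_s #|[set i | face_vector s i != 0%R]|)%N).
  rewrite big_enum_cond /= [leqLHS]big_mkcond; apply: leq_sum => s _.
  case: ifP => // s0; rewrite muln1; apply: cycle_support => // u.
  exact: bdry_face.
apply: (@leq_trans (\sum_(i : oedge) 2)%N); last by rewrite sum_nat_const mulnC.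
rewrite (eq_bigr (fun s => \sum_(i : oedge) (face_vector s i != 0%R : nat))%N); last first.
  by move=> s _; rewrite -sum1dep_card big_mkcond; apply: eq_bigr => i _; case: ifP.
rewrite exchange_big /=; apply: leq_sum => i _.
rewrite -big_mkcond sum1_card.
apply: leq_trans (_ : #|[set face (square_low (lift i).1 (lift i).2);
                     face (square_high (lift i).1 (lift i).2)]| <= 2)%N; last first.
  by rewrite cards2; case: eqP.
apply: subset_leq_card; apply/subsetP => s; rewrite !inE ![s == _]eq_sym.
rewrite unfold_in /= /face_vector ffunE.
by case: (face (square_low _ _) == s) => //; case: (face (square_high _ _) == s).
Qed.

End Counting.

Lemma grid_minor_sparse :
    (forall s : seq V, uniq s -> cycle e s -> (2 < size s)%N -> (12 <= size s)%N) ->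
    A != set0 -> (5 * \sum_(u in A) #|[set v in A | e u v]| < 12 * #|A|)%N.
Proof.
move=> girth /set0Pn[a0 a0A]; rewrite -edge_count.
have ds := leq_trans (dimvS (cycles_span a0)) (dim_span face_vectors).
have d : (#|{: oedge}| < size face_vectors + #|A|)%N.
  exact: leq_trans (dim_cycles a0A) (leq_add ds (leqnn _)).
by have := face_count girth; lia.
Qed.

End GridMinor.

Local Close Scope ring_scope.

(** * From plane drawings to grid minors *)

Section ModelFromBlobs.
Variables (T V E : finType) (r : rel T) (tail head : E -> V).
Variables (B : V -> {set T}) (P : E -> {set T}).
Hypothesis r_sym : symmetric r.

Definition inside (D : {set T}) : rel T := fun x y => [&& r x y, x \in D & y \in D].
Definition connected_set (D : {set T}) := forall x y, x \in D -> y \in D -> connect (inside D) x y.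

Hypotheses (B_conn : forall u, connected_set (B u)) (P_conn : forall i, connected_set (P i)).
Hypothesis B_disj : forall u v x, x \in B u -> x \in B v -> u = v.
Hypothesis P_disj : forall i j x, x \in P i -> x \in P j -> i = j.
Hypothesis PB_disj : forall i w x, x \in P i -> x \in B w -> w = tail i \/ w = head i.
Hypotheses (P_tail : forall i, exists x, x \in P i /\ x \in B (tail i))
  (P_head : forall i, exists x, x \in P i /\ x \in B (head i)).
Hypothesis tail_head : forall i, tail i != head i.

(* The zone of [u] is its blob together with the middle parts of the edges with
   tail [u]; only the component of the blob in it is kept as branch set. *)
Definition zone u : {set T} :=
  B u :|: \bigcup_(i | tail i == u) (P i :\: \bigcup_w B w).

Definition branch u : {set T} :=
  [set x in zone u | [exists b in B u, connect (inside (zone u)) b x]].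

Definition branch_of x : option V := [pick u | x \in branch u].

Lemma zone_disj u v x : x \in zone u -> x \in zone v -> u = v.
Proof.
rewrite !inE; case/orP => [xu|/bigcupP[i /eqP ti /setDP[xi xnB]]];
  case/orP => [xv|/bigcupP[j /eqP tj /setDP[xj xnB']]].
- exact: B_disj xu xv.
- by case/negP: xnB'; apply/bigcupP; exists u.
- by case/negP: xnB; apply/bigcupP; exists v.
- by rewrite -ti -tj (P_disj xi xj).
Qed.

Lemma branch_zone u : branch u \subset zone u.
Proof. by apply/subsetP => x /setIdP[]. Qed.

Lemma B_branch u : B u \subset branch u.
Proof.
apply/subsetP => x xB; rewrite inE inE xB /=.
by apply/existsP; exists x; rewrite xB connect0.
Qed.

Lemma branch_ofE x u : (branch_of x == Some u) = (x \in branch u).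
Proof.
rewrite /branch_of; case: pickP => [v xv|nx]; last by rewrite nx.
apply/eqP/idP => [[<-]//|xu]; congr Some.
exact: zone_disj (subsetP (branch_zone v) _ xv) (subsetP (branch_zone u) _ xu).
Qed.

Lemma branch_closed u x y : x \in branch u -> y \in zone u -> r x y -> y \in branch u.
Proof.
rewrite /branch => /setIdP[xz /existsP[b /andP[bB bx]]] yz rxy.
apply/setIdP; split=> //; apply/existsP; exists b; rewrite bB; apply: connect_trans bx (connect1 _).
by rewrite /inside rxy xz yz.
Qed.

(** Every point of a branch set is linked to the blob within the zone, by a path that cannot leave
    the branch set, and the blob itself is connected. *)
Lemma branch_connected x y u : branch_of x = Some u -> branch_of y = Some u ->
  connect (fun a b => r a b && (branch_of a == branch_of b)) x y.
Proof.
set r' := (X in connect X).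
have r'_sym : connect_sym r'.
  by apply: sym_connect_sym => a b; rewrite /r' r_sym eq_sym.
have step a b : a \in branch u -> connect (inside (zone u)) a b -> connect r' a b.
  move=> aW /connectP[p]; elim: p a aW => [|c p IH] a aW /=; first by move=> _ ->; exact: connect0.
  case/andP => /and3P[rac az cz] pc bE; have cW := branch_closed aW cz rac.
  apply: connect_trans (IH c cW pc bE); apply: connect1; rewrite /r' rac.
  have /eqP-> : branch_of a == Some u by rewrite branch_ofE.
  by have /eqP-> : branch_of c == Some u; rewrite ?branch_ofE ?eqxx.
have base z : z \in branch u -> exists2 b, b \in B u & connect r' b z.
  move=> zW; have /setIdP[_ /existsP[b /andP[bB bz]]] := zW; exists b => //.
  by apply: step bz; apply: (subsetP (B_branch u)).
move=> /eqP; rewrite branch_ofE => /base[b bB bx] /eqP; rewrite branch_ofE => /base[c cB cy].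
apply: (connect_trans _ cy); apply: (@connect_trans _ _ b); first by rewrite r'_sym.
apply: step; first by apply: (subsetP (B_branch u)).
apply: connect_sub (B_conn bB cB) => a d /and3P[rad aB dB]; apply: connect1.
by rewrite /inside rad !inE aB dB.
Qed.

(** Walk along [P i] from the blob of the tail. If no step joins the two branch sets, the walk never
    enters the blob of the head; as [P i] meets no third blob, it then stays in the zone of the
    tail. But it can be led into the blob of the head, and zones are disjoint. *)
Lemma branch_adjacent i : exists x y,
  [/\ r x y, branch_of x = Some (tail i) & branch_of y = Some (head i)].
Proof.
have [x0 [x0P x0B]] := P_tail i; have [y0 [y0P y0B]] := P_head i.
pose good x y := [&& r x y, x \in branch (tail i) & y \in branch (head i)].
have [/existsP[x /existsP[y /and3P[rxy xt yh]]]|no] := boolP [exists x, exists y, good x y].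
  by exists x, y; split=> //; apply/eqP; rewrite branch_ofE.
have sub x : connect (inside (P i)) x0 x -> x \in branch (tail i).
  case/connectP => p; have := subsetP (B_branch _) _ x0B.
  elim: p x0 {x0P x0B} => [|a p IH] b bW /=; first by move=> _ ->.
  case/andP => /and3P[rba bP aP] pa xE; apply: IH pa xE.
  have aH : a \notin B (head i).
    apply: contraNN no => aH; apply/existsP; exists b; apply/existsP; exists a.
    by rewrite /good rba bW (subsetP (B_branch _)).
  apply: branch_closed bW _ rba; rewrite !inE.
  have [//|aT /=] := boolP (a \in B (tail i)).
  apply/bigcupP; exists i => //; rewrite inE aP andbT.
  apply/negP => /bigcupP[w _ aw]; case: (PB_disj aP aw) => wE.
    by rewrite wE (negPf aT) in aw.
  by rewrite wE (negPf aH) in aw.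
have := sub _ (P_conn x0P y0P).
move/(subsetP (branch_zone _)) => y0t; have y0h : y0 \in zone (head i) by rewrite !inE y0B.
by have := tail_head i; rewrite (zone_disj y0t y0h) eqxx.
Qed.

Lemma branch_of_blob x u : branch_of x = Some u ->
  x \in B u \/ exists i, x \in P i.
Proof.
move=> /eqP; rewrite branch_ofE => /(subsetP (branch_zone u)).
rewrite !inE => /orP[|/bigcupP[i _ /setDP[xi _]]]; first by left.
by right; exists i.
Qed.

End ModelFromBlobs.

From mathcomp Require Import all_classical all_reals all_analysis.
Import Order.TTheory Num.Theory.
Import numFieldNormedType.Exports.
Local Open Scope classical_set_scope.
Local Open Scope ring_scope.

(** * Covering plane sets by a fine grid *)

Section GridBlobs.
Variables (R : realType) (m : nat) (d K L : R).
Notation point := ('I_m.+1 * 'I_m.+1)%type.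
Hypotheses (d_gt0 : 0 < d) (KL : K + d < L) (Lm : L + K + d < d * m%:R).

(** The mesh is [d] and the range goes from [-L] to beyond [K + d]: the box of half-width [K] has a
    margin larger than [d] on all sides, so grid points close to it are interior. *)
Definition grid_coord (i : nat) : R := d * i%:R - L.
Definition grid_point (x : point) : R * R := (grid_coord x.1, grid_coord x.2).

(** Balls of [R * R] are open squares, for the maximum norm. With radius equal to the mesh, each
    point of the box lies in the ball of some grid point. *)
Definition blob (X : set (R * R)) : {set point} :=
  finset.finset (fun x => `[< exists2 p, X p & ball (grid_point x) d p >]).

Lemma blobP X x : reflect (exists2 p, X p & ball (grid_point x) d p) (x \in blob X).
Proof. by rewrite finset.inE; apply: asboolP. Qed.

Definition in_box (p : R * R) := `|p.1| <= K /\ `|p.2| <= K.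

Lemma coord_interior (i : nat) (a : R) :
  `|a| <= K -> `|grid_coord i - a| < d -> (0 < i < m)%N.
Proof.
rewrite ler_norml ltr_norml /grid_coord => /andP[a1 a2] /andP[h1 h2].
have [[KL' Lm'] d0] := (KL, Lm, d_gt0).
apply/andP; split.
  by rewrite lt0n; apply/eqP => i0; move: h1 h2; rewrite i0 mulr0 => h1 h2; lra.
rewrite -(ltr_nat R) -(ltr_pM2l d_gt0); lra.
Qed.

Lemma blob_interior X x : X `<=` in_box -> x \in blob X ->
  (0 < x.1 < m)%N /\ (0 < x.2 < m)%N.
Proof.
move=> XK /blobP[p /XK[p1 p2] [h1 h2]].
by split; [apply: coord_interior h1 | apply: coord_interior h2].
Qed.

Lemma coord_cover (a : R) : `|a| <= K -> exists i : 'I_m.+1, `|grid_coord i - a| < d.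
Proof.
rewrite ler_norml => /andP[a1 a2].
have [[KL' Lm'] d0] := (KL, Lm, d_gt0).
have t0 : 0 <= (a + L) / d by rewrite divr_ge0 //; lra.
have /andP[t1 t2] := truncn_itv t0.
set n := Num.trunc _ in t1 t2.
have dn1 : d * n%:R <= a + L by rewrite -ler_pdivlMl // mulrC.
have dn2 : a + L < d * n.+1%:R by rewrite -ltr_pdivrMl // mulrC.
have nm : (n < m.+1)%N.
  by rewrite ltnS ltnW // -(ltr_nat R) -(ltr_pM2l d_gt0); lra.
exists (Ordinal nm); rewrite /grid_coord /= ltr_norml.
move: dn2; rewrite -natr1 mulrDr mulr1 => dn2.
by apply/andP; split; lra.
Qed.

Lemma grid_cover p : in_box p -> exists x, ball (grid_point x) d p.
Proof.
by case=> /coord_cover[i pi] /coord_cover[j pj]; exists (i, j).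
Qed.

Lemma coord_close (i j : nat) (a : R) :
  `|grid_coord i - a| < d -> `|grid_coord j - a| < d -> (i <= j.+1)%N.
Proof.
rewrite /grid_coord !ltr_norml => /andP[h1 h2] /andP[h3 h4].
rewrite -ltnS -(ltr_nat R) -(ltr_pM2l d_gt0) -(natr1 j.+1) -(natr1 j) !mulrDr mulr1.
by have d0 := d_gt0; lra.
Qed.

(* The corner of the rectangle spanned by two grid points close to [p] is again
   close to [p]. *)
Lemma blob_link X x y p : X p -> ball (grid_point x) d p -> ball (grid_point y) d p ->
  connect (inside (@grid_adj m) (blob X)) x y.
Proof.
move=> Xp [x1 x2] [y1 y2]; pose z : point := (y.1, x.2).
have xb : x \in blob X by apply/blobP; exists p.
have yb : y \in blob X by apply/blobP; exists p.
have zb : z \in blob X by apply/blobP; exists p.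
have xy1 := coord_close x1 y1; have yx1 := coord_close y1 x1.
have xy2 := coord_close x2 y2; have yx2 := coord_close y2 x2.
apply: (@connect_trans _ _ z).
  have [->|xz] := eqVneq x z; first exact: connect0.
  apply: connect1; rewrite /inside xb zb !andbT /grid_adj /z /= eqxx /=.
  have : x.1 != y.1 by apply: contraNneq xz => E; rewrite /z -E -surjective_pairing.
  by move: xy1 yx1; rewrite -val_eqE /=; move: (val x.1) (val y.1) => a b; lia.
have [->|zy] := eqVneq z y; first exact: connect0.
apply: connect1; rewrite /inside yb zb !andbT /grid_adj /z /= eqxx /= orbC.
have : x.2 != y.2 by apply: contraNneq zy => E; rewrite /z E -surjective_pairing.
by move: xy2 yx2; rewrite -val_eqE /=; move: (val x.2) (val y.2) => a b; lia.
Qed.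

(** If a grid point of the blob were out of reach from [x], the balls around the reachable grid
    points and those around all others would be two open sets covering [X], both meeting it, and
    disjoint on it by [blob_link]. *)
Lemma blob_connected X : connected X -> X `<=` in_box -> connected_set (@grid_adj m) (blob X).
Proof.
move=> Xc XK x y xb yb; set r := inside _ _; apply: contrapT => nxy.
pose U1 : set (R * R) := \bigcup_(z in [set z | connect r x z]) ball (grid_point z) d.
pose U2 : set (R * R) := \bigcup_(z in [set z | ~ connect r x z]) ball (grid_point z) d.
have [px Xpx xpx] := blobP _ _ xb; have [py Xpy ypy] := blobP _ _ yb.
have U12 p : X p -> U1 p -> ~ U2 p.
  by move=> Xp [z xz zp] [w xw wp]; apply: xw; apply: connect_trans xz (blob_link Xp zp wp).
have XU : X `&` U1 = X.
  apply: Xc.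
  - by exists px; split=> //; exists x => //=; exact: connect0.
  - by exists U1 => //; apply: bigcup_open => z _; exact: ball_open.
  - exists (~` U2).
      by apply: open_closedC; apply: bigcup_open => z _; exact: ball_open.
    apply/seteqP; split=> p [Xp].
      by move=> U1p; split=> //; exact: U12.
    move=> nU2; split=> //; have [z zp] := grid_cover (XK _ Xp).
    by exists z => //=; apply: contrapT => nz; apply: nU2; exists z.
have [_ U1y] : (X `&` U1) py by rewrite XU.
by apply: (U12 _ Xpy U1y); exists y.
Qed.

Lemma blob_meet X Y p : in_box p -> X p -> Y p -> exists x, x \in blob X /\ x \in blob Y.
Proof.
by move=> /grid_cover[x xp] Xp Yp; exists x; split; apply/blobP; exists p.
Qed.

Lemma blob_disjoint X Y x : (forall p q, X p -> Y q -> ~ ball p (d + d) q) ->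
  x \in blob X -> x \in blob Y -> False.
Proof.
move=> XY /blobP[p Xp xp] /blobP[q Yq xq]; apply: (XY p q Xp Yq).
exact: ball_triangle (ball_sym xp) xq.
Qed.

End GridBlobs.

(** * Compactness and connectedness in the plane *)

(** Asserting this for all small [d], rather than for one, lets finitely many separations share a
    common distance. *)
Lemma compact_separated (R : realType) (A B : set (R * R)) :
    compact A -> closed B -> (forall p, A p -> ~ B p) ->
  \forall d \near 0^'+, forall p q, A p -> B q -> ~ ball p d q.
Proof.
move=> /compact_near_coveringP Ac Bc AB.
have H : \forall d \near 0^'+, A `<=` (fun p => forall q, B q -> ~ ball p d q).
  apply: Ac => p Ap.
  have /nbhs_ballP[e /= e0 pe] : nbhs p (~` B) by apply: open_nbhs_nbhs; split; [exact: closed_openC | exact: AB].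
  exists (ball p (e / 2), [set d : R | d < e / 2]) => /=.
    split; first by apply: nbhsx_ballx; rewrite divr_gt0.
    by apply: nbhs_right_lt; rewrite divr_gt0.
  move=> [p' d] [/= pp' de] q Bq p'q; apply: (pe q) => //.
  rewrite (splitr e); apply: ball_triangle pp' _.
  exact: le_ball (ltW de) _ p'q.
by apply: filterS H => d H p q Ap Bq; exact: H.
Qed.

Lemma compact_in_box (R : realType) (A : set (R * R)) :
  compact A -> \forall K \near +oo, A `<=` in_box K.
Proof.
move=> Ac; have Ab : \forall M \near +oo, forall p, A p -> `|p| <= M.
  exact: (compact_bounded Ac).
apply: filterS Ab => K AK p /AK; rewrite prod_normE ge_max => /andP[]; by [].
Qed.

(** The ball is the union of the segments from its center, which all contain the center. *)
Lemma ball_connected (R : realType) (p : R * R) (r : R) : 0 < r -> connected (ball p r).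
Proof.
move=> r0.
pose seg (q : R * R) (t : R) : R * R := (p.1 + t * (q.1 - p.1), p.2 + t * (q.2 - p.2)).
have -> : ball p r = \bigcup_(q in ball p r) (seg q @` `[0, 1]).
  apply/seteqP; split=> [q qr|_ [q [q1 q2] [t t01 <-]]].
    exists q => //; exists 1; first by rewrite /= in_itv /= ler01 lexx.
    by rewrite /seg !mul1r !subrKC -surjective_pairing.
  move: t01; rewrite /= in_itv /= => /andP[t0 t1].
  have scale a b : `|a - b| < r -> `|a - (a + t * (b - a))| < r.
    move=> ab; rewrite opprD addNKr normrN normrM ger0_norm // distrC.
    by apply: le_lt_trans ab; rewrite ler_piMl.
  by split; apply: scale.
apply: bigcup_connected.
  exists p => q qr; exists 0; first by rewrite /= in_itv /= ler01 lexx.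
  by rewrite /seg !mul0r !addr0 -surjective_pairing.
move=> q qr; apply: connected_continuous_connected; first exact: segment_connected.
have affine a b : continuous (fun t : R => a + t * b).
  by move=> t; apply: cvgD; [exact: cvg_cst | apply: cvgMl; exact: cvg_id].
by apply: continuous_subspaceT => t; apply: (cvg_pair (affine _ _ t) (affine _ _ t)).
Qed.

Lemma near_forall (R : realType) (I : finType) (Q : I -> R -> Prop) (F : set_system R) :
  Filter F -> (forall i, \forall d \near F, Q i d) -> \forall d \near F, forall i, Q i d.
Proof. by move=> FF H; apply: filter_forall. Qed.

(** * The grid minor of a plane drawing *)

Section PlaneDrawing.
Variables (R : realType) (G : sgraph) (pos : G -> R * R) (arc : edge G -> R -> R * R).
Hypothesis drawing : is_plane_drawing pos arc.
Implicit Types (E F : edge G) (u v w : G).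

Definition arc_image E : set (R * R) := arc E @` `[0, 1].

Lemma arc_image_compact E : compact (arc_image E).
Proof. apply: continuous_compact; [exact: arc_cont drawing E | exact: segment_compact]. Qed.

Variables (tail head : edge G -> G).
Hypothesis tail_headP : forall E,
  [/\ val E = [set tail E; head E]%SET, arc E 0 = pos (tail E) & arc E 1 = pos (head E)].

Lemma arc_avoids E w p : w != tail E -> w != head E -> arc_image E p -> p <> pos w.
Proof.
move=> wt wh [t]; rewrite /= in_itv /= => /andP[t0 t1] <-.
have [_ at0 at1] := tail_headP E.
have [->|tn0] := eqVneq t 0.
  by rewrite at0 => /(pos_inj drawing) E'; rewrite E' eqxx in wt.
have [->|tn1] := eqVneq t 1.
  by rewrite at1 => /(pos_inj drawing) E'; rewrite E' eqxx in wh.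
by apply: (arc_vertex drawing); rewrite in_itv /= !lt_neqAle t0 t1 tn1 eq_sym tn0.
Qed.

Lemma near_avoids : \forall d \near (0 : R)^'+,
  (forall v w, v != w -> ~ ball (pos v) d (pos w)) /\
  (forall E w, w != tail E -> w != head E -> forall p, arc_image E p -> ~ ball p d (pos w)).
Proof.
have sep A w : compact A -> (forall p, A p -> p <> pos w) ->
    \forall d \near (0 : R)^'+, forall p, A p -> ~ ball p d (pos w).
  move=> Ac Aw; have : closed [set pos w].
    by apply: compact_closed; [exact: norm_hausdorff | exact: compact_set1].
  move/(compact_separated Ac) => H.
  have /H{}H : forall p, A p -> ~ [set pos w] p by move=> p Ap pw; exact: (Aw p Ap).
  by apply: filterS H => d H p Ap; apply: H.
have H1 : \forall d \near (0 : R)^'+, forall vw : G * G, vw.1 != vw.2 -> ~ ball (pos vw.1) d (pos vw.2).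
  apply: near_forall => -[v w] /=.
  have [->|vw] := eqVneq v w; first by apply: nearW => d.
  have : \forall d \near (0 : R)^'+, forall p, [set pos v] p -> ~ ball p d (pos w).
    apply: sep; first exact: compact_set1.
    by move=> p -> /(pos_inj drawing) E; rewrite E eqxx in vw.
  by apply: filterS => d H _; exact: H.
have H2 : \forall d \near (0 : R)^'+, forall Ew : edge G * G,
    Ew.2 != tail Ew.1 -> Ew.2 != head Ew.1 ->
    forall p, arc_image Ew.1 p -> ~ ball p d (pos Ew.2).
  apply: near_forall => -[E w] /=.
  have [wt|wt] := eqVneq w (tail E); first by apply: nearW => d.
  have [wh|wh] := eqVneq w (head E); first by apply: nearW => d.
  have : \forall d \near (0 : R)^'+, forall p, arc_image E p -> ~ ball p d (pos w).
    by apply: sep; [exact: arc_image_compact | move=> p; exact: arc_avoids].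
  by apply: filterS => d H _ _; exact: H.
apply: filterS2 H1 H2 => d H1 H2; split=> [v w|E w]; first exact: (H1 (v, w)).
exact: (H2 (E, w)).
Qed.

(** The bound 1/2 here and in [near_end] puts the two cut points of an arc in the right order. *)
Lemma near_start E r : 0 < r -> exists s, 0 < s < 2^-1 /\ ball (pos (tail E)) r (arc E s).
Proof.
move=> r0; have [_ <- _] := tail_headP E.
have := @arc_cont _ _ _ _ drawing E; rewrite continuous_within_itvP ?ltr01 // => -[_ c0 _].
have : \forall s \near (0 : R)^'+, ball (arc E 0) r (arc E s).
  exact: (c0 (ball (arc E 0) r) (nbhsx_ballx _ _ r0)).
move=> H; have [] := @filter_ex _ (0 : R)^'+ _ [set s | 0 < s < 2^-1 /\ ball (arc E 0) r (arc E s)].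
  near=> s; split; last by near: s.
  apply/andP; split; [by near: s; exact: nbhs_right_gt | near: s; apply: nbhs_right_lt; by rewrite invr_gt0].
by move=> s; exists s.
Unshelve. all: by end_near. Qed.

Lemma near_end E r : 0 < r -> exists s, 2^-1 < s < 1 /\ ball (pos (head E)) r (arc E s).
Proof.
move=> r0; have [_ _ <-] := tail_headP E.
have := @arc_cont _ _ _ _ drawing E; rewrite continuous_within_itvP ?ltr01 // => -[_ _ c1].
have : \forall s \near (1 : R)^'-, ball (arc E 1) r (arc E s).
  exact: (c1 (ball (arc E 1) r) (nbhsx_ballx _ _ r0)).
move=> H; have [] := @filter_ex _ (1 : R)^'- _ [set s | 2^-1 < s < 1 /\ ball (arc E 1) r (arc E s)].
  near=> s; split; last by near: s.
  apply/andP; split; [near: s; apply: nbhs_left_gt; by rewrite invf_lt1 ?ltr1n | by near: s; exact: nbhs_left_lt].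
by move=> s; exists s.
Unshelve. all: by end_near. Qed.

Lemma adj_set2 (u v a b : G) : adj u v -> [set u; v]%SET = [set a; b]%SET ->
  (a = u /\ b = v) \/ (a = v /\ b = u).
Proof.
move=> uv S; have neq : u != v by apply: contraTneq uv => ->; rewrite adj_irrefl.
have : a \in [set u; v]%SET by rewrite S finset.set21.
have : b \in [set u; v]%SET by rewrite S finset.set22.
have : u \in [set a; b]%SET by rewrite -S finset.set21.
have : v \in [set a; b]%SET by rewrite -S finset.set22.
rewrite !finset.inE => va ua /orP[]/eqP bE /orP[]/eqP aE; rewrite aE bE in va ua *; auto.
  by rewrite eq_sym orbb (negPf neq) in va.
by rewrite orbb (negPf neq) in ua.
Qed.

Lemma edge_adj E u v : val E = [set u; v]%SET -> adj u v.
Proof.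
move=> Euv; have := valP E; rewrite Euv => /finset.imset2P[a b _].
rewrite finset.inE => /andP[_ ab] /esym/(adj_set2 ab)[[-> ->]//|[-> ->]].
by rewrite adj_sym.
Qed.

Lemma exists_edge u v : adj u v -> exists E, val E = [set u; v]%SET.
Proof.
move=> uv; have H : [set u; v]%SET \in edge_set G.
  by apply/finset.imset2P; exists u v; rewrite ?finset.inE.
by exists (exist (fun X : {set G} => X \in edge_set G) _ H).
Qed.

(** The order of choices matters. Arcs may meet at common ends, so they are first cut inside the
    balls of radius [r] around these; only the middle parts are pairwise disjoint compact sets, and
    the mesh [d] is adapted to the distances between them. *)
Theorem drawing_grid_model :
  exists m (phi : 'I_m.+1 * 'I_m.+1 -> option G), [/\
    forall x u, phi x = Some u -> (0 < x.1 < m)%N /\ (0 < x.2 < m)%N,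
    forall x y u, phi x = Some u -> phi y = Some u ->
      connect (fun a b => grid_adj a b && (phi a == phi b)) x y &
    forall u v, adj u v -> exists x y, [/\ grid_adj x y, phi x = Some u & phi y = Some v]].
Proof.
have [r4 [r4_gt0 [pos_far arc_far]]] : exists d : R, 0 < d /\
    ((forall v w, v != w -> ~ ball (pos v) d (pos w)) /\
    (forall E w, w != tail E -> w != head E -> forall p, arc_image E p -> ~ ball p d (pos w))).
  have [d [d0 dP]] := filter_ex (filterI (nbhs_right_gt (0 : R)) near_avoids).
  by exists d.
(* Blobs of two vertices are disjoint once [r + 2 d + r] is at most [r4]; as [d] will be at most
   [r], a quarter suffices. *)
pose r := r4 / 4; have r0 : 0 < r by rewrite divr_gt0.
have [s sP] := choice (fun E => near_start E r0).
have [t tP] := choice (fun E => near_end E r0).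
pose mid E := arc E @` `[s E, t E].
have st E : s E <= t E.
  by have [/andP[_ s1] _] := sP E; have [/andP[t1 _] _] := tP E; rewrite ltW // (lt_trans s1).
have mid_itv E : `[s E, t E] `<=` (`]0, 1[ : set R).
  have [/andP[s0 _] _] := sP E; have [/andP[_ t1] _] := tP E.
  move=> x; rewrite /= !in_itv /= => /andP[sx xt].
  by rewrite (lt_le_trans s0) // (le_lt_trans xt).
have mid_sub E : mid E `<=` arc_image E.
  move=> p [x /mid_itv x01 <-]; exists x => //; move: x01; rewrite /= !in_itv /=.
  by case/andP => /ltW-> /ltW->.
have mid_cont E : {within `[s E, t E], continuous (arc E)}.
  apply: continuous_subspaceW (@arc_cont _ _ _ _ drawing E).
  by move=> x /mid_itv; rewrite /= !in_itv /= => /andP[/ltW-> /ltW->].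
have mid_compact E : compact (mid E).
  by apply: continuous_compact; [exact: mid_cont | exact: segment_compact].
have mid_connected E : connected (mid E).
  by apply: connected_continuous_connected; [exact: segment_connected | exact: mid_cont].
have mid_disj E F p : E != F -> mid E p -> ~ mid F p.
  move=> EF [x /mid_itv xE <-] [y /mid_itv yF yx].
  by have := arc_disj drawing EF xE yF; rewrite yx.
have [d2 [d2_gt0 mid_far]] : exists d : R, 0 < d /\
    forall E F, E != F -> forall p q, mid E p -> mid F q -> ~ ball p d q.
  have H : \forall d \near (0 : R)^'+, forall EF : edge G * edge G, EF.1 != EF.2 ->
      forall p q, mid EF.1 p -> mid EF.2 q -> ~ ball p d q.
    apply: near_forall => -[E F] /=; have [->|EF] := eqVneq E F; first by apply: nearW.
    have : \forall d \near (0 : R)^'+, forall p q, mid E p -> mid F q -> ~ ball p d q.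
      apply: compact_separated => // [|p]; last exact: mid_disj.
      by apply: compact_closed => //; exact: norm_hausdorff.
    by apply: filterS => d H _.
  have [d [d0 dP]] := filter_ex (filterI (nbhs_right_gt (0 : R)) H).
  by exists d; split=> // E F EF; exact: (dP (E, F)).
(* A grid point common to two blobs brings the sets within [2 d] of each other, hence half of
   [d2]. *)
pose d := Num.min (d2 / 2) r.
have d0 : 0 < d by rewrite lt_min divr_gt0.
have dr : d <= r by rewrite ge_min lexx orbT.
have dd : d + d <= d2.
  by have : d <= d2 / 2 by [rewrite ge_min lexx]; lra.
have [K [mid_box pos_box]] : exists K, (forall E, mid E `<=` in_box K) /\
    (forall v, ball (pos v) r `<=` in_box K).
  have H1 : \forall K \near +oo, forall E, mid E `<=` in_box K.
    by apply: near_forall => E; apply: compact_in_box.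
  have H2 : \forall K \near +oo, forall v, ball (pos v) r `<=` in_box K.
    apply: near_forall => v; near=> K.
    move=> p [p1 p2]; have pK : `|pos v| + r <= K by near: K; apply: nbhs_pinfty_ge; rewrite num_real.
    move: pK; rewrite prod_normE -lerBrDr ge_max => /andP[v1 v2].
    have tri (a b : R) : `|a - b| < r -> `|a| <= K - r -> `|b| <= K.
      move=> ab aK; rewrite -(subrK a b) (le_trans (ler_normD _ _)) // distrC.
      lra.
    by split; [exact: tri p1 v1 | exact: tri p2 v2].
  by have [K [HK1 HK2]] := filter_ex (filterI H1 H2); exists K.
pose L := K + d + 1; pose m := (Num.trunc ((L + K + d) / d)).+1.
have KL : K + d < L by rewrite /L ltrDl.
have Lm : L + K + d < d * m%:R by rewrite -ltr_pdivrMl // mulrC truncnS_gt.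
pose B v := blob m d L (ball (pos v) r); pose P E := blob m d L (mid E).
have B_conn v : connected_set (@grid_adj m) (B v).
  exact: (blob_connected d0 KL Lm (ball_connected r0) (pos_box v)).
have P_conn E : connected_set (@grid_adj m) (P E).
  exact: (blob_connected d0 KL Lm (mid_connected E) (mid_box E)).
have r4E : r4 = r + r + (r + r) by rewrite /r; lra.
have B_disj u v x : x \in B u -> x \in B v -> u = v.
  move=> xu xv; apply/eqP; apply: contrapT => /negP uv.
  apply: (blob_disjoint _ xu xv) => p q pu qv pq; apply: (pos_far _ _ uv).
  have dd4 : r + (d + d) + r <= r4 by lra.
  apply: (le_ball dd4); apply: ball_triangle (ball_sym qv).
  exact: ball_triangle pu pq.
have P_disj E F x : x \in P E -> x \in P F -> E = F.
  move=> xE xF; apply/eqP; apply: contrapT => /negP EF.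
  apply: (blob_disjoint _ xE xF) => p q pE qF pq; apply: (mid_far _ _ EF _ _ pE qF).
  exact: (le_ball dd).
have PB_disj E w x : x \in P E -> x \in B w -> w = tail E \/ w = head E.
  move=> xE xw; have [->|wt] := eqVneq w (tail E); first by left.
  have [->|wh] := eqVneq w (head E); first by right.
  exfalso; apply: (blob_disjoint _ xE xw) => p q pE qw pq.
  apply: (arc_far _ _ wt wh _ (mid_sub _ _ pE)).
  have dd4 : d + d + r <= r4 by lra.
  by apply: (le_ball dd4); apply: ball_triangle pq (ball_sym qw).
have P_tail E : exists x, x \in P E /\ x \in B (tail E).
  have [_ sb] := sP E; apply: (blob_meet d0 KL Lm _ _ sb); first exact: (pos_box _ _ sb).
  by exists (s E) => //=; rewrite in_itv /= lexx st.
have P_head E : exists x, x \in P E /\ x \in B (head E).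
  have [_ tb] := tP E; apply: (blob_meet d0 KL Lm _ _ tb); first exact: (pos_box _ _ tb).
  by exists (t E) => //=; rewrite in_itv /= lexx st.
have tail_adj E : adj (tail E) (head E).
  by have [EE _ _] := tail_headP E; exact: edge_adj EE.
have tail_head E : tail E != head E.
  by apply: contraTneq (tail_adj E) => ->; rewrite adj_irrefl.
exists m, (branch_of (@grid_adj m) tail B P); split.
- move=> x u xu; have [|[E]] := branch_of_blob B_disj P_disj xu; last exact: (blob_interior d0 KL Lm (mid_box E)).
  exact: (blob_interior d0 KL Lm (pos_box u)).
- move=> x y u.
  exact: (branch_connected (@grid_adj_sym m) B_conn B_disj P_disj).
- move=> u v uv; have [E Euv] := exists_edge uv.
  have [x [y [xy xt yh]]] :=
    branch_adjacent P_conn B_disj P_disj PB_disj P_tail P_head tail_head E.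
  have [EE _ _] := tail_headP E; rewrite Euv in EE.
  case: (adj_set2 uv EE) => -[<- <-]; first by exists x, y.
  by exists y, x; rewrite grid_adj_sym.
Unshelve. all: by end_near. Qed.

End PlaneDrawing.

Local Close Scope ring_scope.
Local Close Scope classical_set_scope.

(** * Packing edge-colorings *)

Section PackingOfColoring.
Variables (G : sgraph) (S : G -> {set 'I_6}) (c : G -> G -> 'I_6).
Hypothesis col : coloring (@adj G) [set: G]%SET S c.
Implicit Types (E F M : edge G) (u v w : G).

Lemma edge_ends E u : u \in val E -> exists v, adj u v /\ val E = [set u; v]%SET.
Proof.
have /finset.imset2P[a b _] := valP E; rewrite finset.inE => /andP[_ ab] ->.
rewrite !finset.inE => /orP[]/eqP->; first by exists b.
by exists a; rewrite adj_sym finset.setUC.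
Qed.

(** The color of an edge is read off at either end, consistently by [col_sym]. Adjacent edges differ
    by [col_inj], and [col_far] leaves 0 as the only color that edges at distance 2 can share. *)
Lemma packing_of_coloring : packing_edge_colorable G 1 5.
Proof.
have inT u : u \in [set: G]%SET by rewrite finset.in_setT.
have ends E : exists u, u \in val E.
  have /finset.imset2P[a b _ _ ->] := valP E; by exists a; rewrite finset.set21.
have [end1 end1P] := choice ends.
have [end2 end2P] := choice (fun E => edge_ends (end1P E)).
pose k E := c (end1 E) (end2 E).
have kE E u v : adj u v -> val E = [set u; v]%SET -> k E = c u v.
  move=> uv EE; have [adj12 E12] := end2P E.
  rewrite EE in E12; case: (adj_set2 uv E12) => -[e1 e2]; rewrite /k e1 e2 //.
  by apply: (col_sym col); rewrite // adj_sym.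
have far1 E F u : E != F -> u \in val E -> u \in val F -> k E != k F.
  move=> EF /edge_ends[a [ua EE]] /edge_ends[b [ub FE]].
  apply: contraNneq EF => kEF; apply/eqP/val_inj; rewrite EE FE.
  have : c u a = c u b by rewrite -(kE E) // -(kE F).
  by move/(col_inj col (inT u)) => -> //; rewrite finset.inE ?ua ?ub finset.in_setT.
(* For distinct [u] and [v] the common color lies in [S u] and in [S v], so it is 0 or the color of
   [M]; the latter is excluded because [E] and [M] meet at [u]. If [u] and [v] coincide, [E] and [F]
   are adjacent. *)
have far2 E M F u v : E != M -> E != F -> u \in val E -> u \in val M -> v \in val M ->
    v \in val F -> k E = k F -> k E = ord0.
  move=> EM EF uE uM vM vF kEF; have [uv|uv] := eqVneq u v.
    by have := far1 _ _ _ EF uE; rewrite uv => /(_ vF); rewrite kEF eqxx.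
  have [a [ua EE]] := edge_ends uE; have [b [vb FE]] := edge_ends vF.
  have [w [uw ME]] := edge_ends uM.
  have wv : w = v by move: vM; rewrite ME !finset.inE eq_sym (negPf uv) => /eqP.
  subst w; have := fintype.subsetP (col_far col (inT u) (inT v) uw) (k E).
  rewrite finset.inE {1}(kE _ _ _ ua EE) (col_mem col) // kEF (kE _ _ _ vb FE) (col_mem col) //.
  rewrite !finset.inE => /(_ isT)/orP[/eqP//|/eqP kM].
  by have := far1 _ _ _ EM uE uM; rewrite kEF (kE _ _ _ vb FE) kM (kE _ _ _ uw ME) eqxx.
have share E F : line_adj E F -> E != F /\ exists2 u, u \in val E & u \in val F.
  by case/andP => EF /finset.set0Pn[u /finset.setIP[uE uF]]; split=> //; exists u.
(* Splitting sends color 0 to the left summand, the matching, and the other five colors to the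
   right. It remains to inspect walks of length at most 2 in the line graph. *)
exists (fun E => fintype.split (k E : 'I_(1 + 5))) => E F EF /(can_inj (@splitK 1 5)) kEF p.
case: p => [|M [|F' [|? ?]]] //=.
- by move=> _ EF'; rewrite EF' eqxx in EF.
- rewrite andbT => /share[_ [u uE uF]] MF; rewrite MF in uF.
  by have := far1 _ _ _ EF uE uF; rewrite kEF eqxx.
- rewrite andbT => /andP[/share[EM [u uE uM]] /share[_ [v vM vF]]] FF'; rewrite FF' in vF.
  have k0 := far2 _ _ _ _ _ EM EF uE uM vM vF kEF.
  by case: fintype.splitP => // j; rewrite k0.
- by case: (fintype.split _).
Qed.

End PackingOfColoring.

Theorem theorem1p1 (R : realType) (G : sgraph)
  (Hsubcubic : subcubic G) (Hplanar : planar R G) (Hgirth : girth_geq G 12) :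
  packing_edge_colorable G 1 5.
Proof.
have girth s : uniq s -> cycle (@adj G) s -> 2 < size s -> 12 <= size s.
  by move=> Us cs ss; apply: Hgirth; split=> //; rewrite /ucycle cs Us.
have [pos [arc drawing]] := Hplanar.
have ends E : exists uv : G * G, [/\ val E = [set uv.1; uv.2]%SET,
    arc E 0%R = pos uv.1 & arc E 1%R = pos uv.2].
  by have [u [v H]] := arc_ends drawing E; exists (u, v).
have [th thP] := choice ends.
have [m [phi [phi_interior phi_connected phi_adj]]] :=
  drawing_grid_model drawing (tail := fun E => (th E).1) (head := fun E => (th E).2) thP.
have [S [c col]] : colorable (@adj G) [set: G]%SET.
  apply: sparse_colorable; [exact: adj_sym | exact: adj_irrefl | | |].
  - by move=> s Us cs ss; apply: leq_trans (girth s Us cs ss).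
  - move=> A v _; apply: leq_trans (Hsubcubic v); apply: subset_leq_card.
    by apply/fintype.subsetP => u; rewrite !finset.inE => /andP[].
  - move=> A; exact: (grid_minor_sparse (@adj_sym G) (@adj_irrefl G) phi_interior phi_connected phi_adj girth).
exact: packing_of_coloring col.
Qed.
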